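(* Let $q\in\mathbb{C}$ with $|q|<1$, and define \[ S(q):=\sum_{n\ge 0}\frac{\left(q;q^2\right)^2_n\, q^{2n}}{\left(-q^2;q^2\right)_n}. \] Then \[ \left(\left(q^4;q^4\right)_{\infty}S(q)\right)\bigm| S_{2,0}=\sum_{n\ge 0}(-1)^nq^{6n^2+4n}\left(1+q^{4n+2}\right)\sum_{|j|\le n}(-1)^{j}q^{-2j^2}, \] where the inner sum runs over all integers $j$ with $|j|\le n$.
   Context: For $n\in\mathbb{N}_0\cup\{\infty\}$, $(a;q)_n:=\prod_{j=0}^{n-1}(1-aq^j)$ is the $q$-Pochhammer symbol, and $(a,b;q)_n:=(a;q)_n(b;q)_n$. For $N\in\mathbb{N}$ and $r\in\mathbb{Z}$, the sieving operator $S_{N,r}$ acts on a power series $f(q)=\sum_{n\ge0}c(n)q^n$ by $f(q)\bigm|S_{N,r}:=\sum_{n\equiv r \pmod N} c(n)q^n$. *)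

(* Defs.v *)
From Stdlib Require Import Reals ZArith.
From Coquelicot Require Import Coquelicot.
Open Scope C_scope.

Fixpoint cpow (z : C) (n : nat) : C :=
  match n with O => 1 | S k => z * cpow z k end.

Fixpoint qpoch (a q : C) (n : nat) : C :=
  match n with O => 1 | S k => qpoch a q k * (1 - a * cpow q k) end.

Definition qpoch_inf_is (a q P : C) : Prop :=
  filterlim (fun n => qpoch a q n) eventually (locally P).

Definition S_term (q : C) (n : nat) : C :=
  (qpoch q (q * q) n * qpoch q (q * q) n * cpow q (2 * n))
    / qpoch (- (q * q)) (q * q) n.

(* n-th term of the right-hand side:
   (-1)^n q^{6n^2+4n} (1 + q^{4n+2}) sum_{|j|<=n} (-1)^j q^{-2j^2},
   written with nonnegative exponents 6n^2+4n-2j^2 >= 0 (j = k - n, 0<=k<=2n). *)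
Definition rhs_term (q : C) (n : nat) : C :=
  cpow (-1) n *
  sum_n (fun k : nat =>
     let j := (Z.of_nat k - Z.of_nat n)%Z in
     cpow (-1) (Z.abs_nat j) *
     (cpow q (Z.to_nat (6 * Z.of_nat n * Z.of_nat n + 4 * Z.of_nat n - 2 * j * j))
      + cpow q (Z.to_nat (6 * Z.of_nat n * Z.of_nat n + 8 * Z.of_nat n + 2 - 2 * j * j))))
    (2 * n).

Definition sieve20_term (c : nat -> C) (z : C) (n : nat) : C :=
  if Nat.even n then c n * cpow z n else 0.

(* Main.v *)
Require Import Defs.
From Stdlib Require Import Reals ZArith Lra Lia.
From Coquelicot Require Import Coquelicot.
Open Scope C_scope.

(** Put [Q = q^2]. Since [(q^4;q^4)_oo] is even in [q], only the even part of [S] matters.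
    By the finite Jacobi triple product,
    [(q;Q)_n^2 = sum_{|s|<=n} (-1)^s q^{s^2} [2n; n+s]_Q], whose even part keeps the even
    [s = 2j]. Exchanging sums leaves, for every [s], the series
    [sum_n Q^n [2n; n+s]_Q / (-Q;Q)_n]. A Gosper-type certificate shows that
    [G s = (Q^2;Q^2)_oo Q^{-s}] times this series satisfies
    [G s = 1 + Q^{s+1} - Q^{3s+5} G (s+2)], so that iterating gives
    [G s = sum_k (-1)^k Q^{3k^2+2k+3ks} (1 + Q^{2k+1+s})].
    Putting [s = 2|j|] and summing along [n = k + |j|] gives the Hecke-type double sum. *)

(** The statement asks for one coefficient sequence [c], the same for every $q$, so comparing values
    is not enough: $(q^4;q^4)_\infty S(q)$ has to be exhibited as a power series. The factorisation
    $(q^4;q^4)_n=(q^2;q^2)_n(-q^2;q^2)_n$ clears the denominators of the first $n$ terms of $S$, so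
    their sum times $(q^4;q^4)_n$ is a polynomial. Its coefficients stabilise and are bounded in a
    weighted norm uniformly in $n$; sieving then becomes averaging the values at $q$ and $-q$.

    Each interchange of limits is dominated convergence with a geometric majorant, which is why
    $(a;q)_n$ and its inverse need bounds uniform in $n$. Decay in $j$ comes from the factor
    $q^{s^2}$ of the triple product.

    The power $Q^{-s}$ is never formed: the inner series starts at $n=s$, and writing $n=s+m$
    removes $Q^s$ beforehand, so $q=0$ is no special case. The iteration converges because its
    $k$-th remainder carries $Q^{3k^2+2k+3ks}$ while $G$ is bounded uniformly in $s$. *)

Lemma cpow_add (z : C) (m n : nat) : cpow z (m + n) = cpow z m * cpow z n.
Proof. induction m as [|m IH]; simpl; [|rewrite IH]; ring. Qed.

Lemma cpow_mul (z : C) (m n : nat) : cpow z (m * n) = cpow (cpow z m) n.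
Proof.
  induction n as [|n IH]; [rewrite Nat.mul_0_r; reflexivity|].
  rewrite Nat.mul_succ_r, cpow_add, IH; simpl; ring.
Qed.

Lemma cpow_neg (z : C) (n : nat) : cpow (- z) n = cpow (-1) n * cpow z n.
Proof. induction n as [|n IH]; simpl; [|rewrite IH]; ring. Qed.

Lemma cpow_m1_double (n : nat) : cpow (-1) (2 * n) = 1.
Proof.
  rewrite cpow_mul. replace (cpow (-1) 2) with (RtoC 1) by (simpl; ring).
  induction n as [|n IH]; simpl; [|rewrite IH]; ring.
Qed.

Lemma Cmod_cpow (z : C) (n : nat) : Cmod (cpow z n) = (Cmod z ^ n)%R.
Proof.
  induction n as [|n IH]; simpl; [apply Cmod_1|].
  now rewrite Cmod_mult, IH.
Qed.

Lemma Cmod_sub_sym (x y : C) : Cmod (x - y) = Cmod (y - x).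
Proof. rewrite <- Cmod_opp. f_equal. ring. Qed.

Lemma Cmod_sub_le (x y : C) : (Cmod (x - y) <= Cmod x + Cmod y)%R.
Proof.
  unfold Cminus. eapply Rle_trans; [apply Cmod_triangle|].
  rewrite Cmod_opp. lra.
Qed.

Lemma pow_le_1_anti (r : R) (m n : nat) :
  (0 <= r <= 1)%R -> (m <= n)%nat -> (r ^ n <= r ^ m)%R.
Proof.
  intros Hr Hmn. replace n with (m + (n - m))%nat by lia. rewrite pow_add.
  assert (H1 : (0 <= r ^ m)%R) by (apply pow_le; lra).
  assert (H2 : (r ^ (n - m) <= 1)%R).
  { rewrite <- (pow1 (n - m)). apply pow_incr. lra. }
  assert (H3 : (0 <= r ^ (n - m))%R) by (apply pow_le; lra).
  nra.
Qed.

(** * Limits and series in C *)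

(** Convergence in [C] is expressed through one real sequence, so that the limit laws and the
    squeeze theorem for [is_lim_seq] apply directly. *)
Definition cv (u : nat -> C) (l : C) : Prop :=
  is_lim_seq (fun n => Cmod (u n - l)) 0%R.

Lemma cv_iff_filterlim (u : nat -> C) (l : C) :
  cv u l <-> filterlim u eventually (locally l).
Proof.
  unfold cv, is_lim_seq. split; intros H.
  - apply filterlim_locally. intros eps.
    assert (H' := proj1 (filterlim_locally _ _) H eps).
    revert H'; apply filter_imp; intros n Hn.
    apply C_NormedModule_mixin_compat1.
    unfold ball in Hn; simpl in Hn; unfold AbsRing_ball, abs, minus, plus, opp in Hn; simpl in Hn.
    change (Rabs (Cmod (u n - l) + - 0) < eps)%R in Hn.
    rewrite Ropp_0, Rplus_0_r, Rabs_pos_eq in Hn by apply Cmod_ge_0. exact Hn.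
  - apply filterlim_locally. intros eps.
    (* Balls of [C] are products of real balls, so membership in a ball of radius $\varepsilon$ only
       bounds the modulus by $\sqrt2\,\varepsilon$. *)
    assert (Hs : (0 < sqrt 2)%R) by (apply sqrt_lt_R0; lra).
    assert (He : (0 < eps / sqrt 2)%R) by (apply Rdiv_lt_0_compat; [apply cond_pos|exact Hs]).
    assert (H' := proj1 (filterlim_locally _ _) H (mkposreal _ He)).
    revert H'; apply filter_imp; intros n Hn.
    apply (C_NormedModule_mixin_compat2 l (u n)) in Hn.
    change (Rabs (Cmod (u n - l) + - 0) < eps)%R.
    rewrite Ropp_0, Rplus_0_r, Rabs_pos_eq by apply Cmod_ge_0.
    eapply Rlt_le_trans; [exact Hn|]. simpl. right. field. lra.
Qed.

Lemma cv_le (u : nat -> C) (l : C) (b : nat -> R) :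
  (forall n, (Cmod (u n - l) <= b n)%R) -> is_lim_seq b 0%R -> cv u l.
Proof.
  intros H Hb. unfold cv.
  apply is_lim_seq_le_le with (fun _ => 0%R) b.
  - intros n. split; [apply Cmod_ge_0|apply H].
  - apply is_lim_seq_const.
  - exact Hb.
Qed.

Lemma cv_ext (u v : nat -> C) (l : C) : (forall n, u n = v n) -> cv u l -> cv v l.
Proof. intros H. apply is_lim_seq_ext. intros n. now rewrite H. Qed.

Lemma cv_const (l : C) : cv (fun _ => l) l.
Proof.
  apply cv_le with (fun _ => 0%R); [|apply is_lim_seq_const].
  intros _. replace (l - l) with (RtoC 0) by ring. rewrite Cmod_0. lra.
Qed.

Lemma cv_plus (u v : nat -> C) (l m : C) :
  cv u l -> cv v m -> cv (fun n => u n + v n) (l + m).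
Proof.
  intros Hu Hv.
  apply cv_le with (fun n => (Cmod (u n - l) + Cmod (v n - m))%R).
  - intros n. replace (u n + v n - (l + m)) with ((u n - l) + (v n - m)) by ring.
    apply Cmod_triangle.
  - replace (Finite 0) with (Finite (0 + 0)) by (f_equal; ring).
    now apply is_lim_seq_plus'.
Qed.

Lemma cv_mult (u v : nat -> C) (l m : C) :
  cv u l -> cv v m -> cv (fun n => u n * v n) (l * m).
Proof.
  intros Hu Hv.
  apply cv_le with (fun n => (Cmod (u n - l) * Cmod (v n - m)
     + (Cmod l * Cmod (v n - m) + Cmod m * Cmod (u n - l)))%R).
  - intros n.
    replace (u n * v n - l * m)
      with ((u n - l) * (v n - m) + (l * (v n - m) + m * (u n - l))) by ring.
    eapply Rle_trans; [apply Cmod_triangle|]. rewrite Cmod_mult.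
    apply Rplus_le_compat_l.
    eapply Rle_trans; [apply Cmod_triangle|]. rewrite !Cmod_mult. lra.
  - replace (Finite 0) with (Finite (0 * 0 + (Cmod l * 0 + Cmod m * 0))) by (f_equal; ring).
    apply is_lim_seq_plus'; [now apply is_lim_seq_mult'|].
    apply is_lim_seq_plus'; apply is_lim_seq_mult'; auto using is_lim_seq_const.
Qed.

Lemma cv_scal (a : C) (u : nat -> C) (l : C) :
  cv u l -> cv (fun n => a * u n) (a * l).
Proof. intros H. apply cv_mult; [apply cv_const|exact H]. Qed.

Lemma cv_incr (u : nat -> C) (l : C) : cv (fun n => u (S n)) l <-> cv u l.
Proof.
  symmetry. apply (is_lim_seq_incr_1 (fun n => Cmod (u n - l))).
Qed.

Lemma cv_incr_n (k : nat) (u : nat -> C) (l : C) :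
  cv (fun n => u (n + k)%nat) l <-> cv u l.
Proof.
  symmetry. apply (is_lim_seq_incr_n (fun n => Cmod (u n - l)) k).
Qed.

(** From $1/u-1/l=(l-u)/(ul)$. The uniform bound [K], available for q-Pochhammer symbols, replaces
    the usual argument that [u] eventually stays away from 0. *)
Lemma cv_inv (u : nat -> C) (l : C) (K : R) :
  (forall n, u n <> 0) -> (forall n, (Cmod (/ u n) <= K)%R) -> l <> 0 ->
  cv u l -> cv (fun n => / u n) (/ l).
Proof.
  intros H0 HK Hl Hu.
  apply cv_le with (fun n => (K * Cmod (/ l) * Cmod (u n - l))%R).
  - intros n. replace (/ u n - / l) with (/ u n * / l * (l - u n)) by (field; auto).
    rewrite !Cmod_mult, (Cmod_sub_sym l).
    apply Rmult_le_compat_r; [apply Cmod_ge_0|].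
    apply Rmult_le_compat_r; [apply Cmod_ge_0|apply HK].
  - replace (Finite 0) with (Finite (K * Cmod (/ l) * 0)) by (f_equal; ring).
    apply is_lim_seq_mult'; [apply is_lim_seq_const|exact Hu].
Qed.

Lemma cv_unique (u : nat -> C) (l m : C) : cv u l -> cv u m -> l = m.
Proof.
  intros Hl Hm.
  assert (H : is_lim_seq (fun _ : nat => Cmod (l - m)) 0%R).
  { apply is_lim_seq_le_le with (fun _ => 0%R)
      (fun n => (Cmod (u n - l) + Cmod (u n - m))%R).
    - intros n. split; [apply Cmod_ge_0|].
      replace (l - m) with ((u n - m) - (u n - l)) by ring.
      eapply Rle_trans; [apply Cmod_sub_le|]. lra.
    - apply is_lim_seq_const.
    - replace (Finite 0) with (Finite (0 + 0)) by (f_equal; ring).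
      now apply is_lim_seq_plus'. }
  assert (H' := is_lim_seq_const (Cmod (l - m))).
  apply is_lim_seq_unique in H. apply is_lim_seq_unique in H'.
  rewrite H in H'. injection H' as H'. symmetry in H'. apply Cmod_eq_0 in H'.
  replace l with (l - m + m) by ring. rewrite H'. ring.
Qed.

Lemma cv_Cmod_le (u : nat -> C) (l : C) (B : R) :
  (forall n, (Cmod (u n) <= B)%R) -> cv u l -> (Cmod l <= B)%R.
Proof.
  intros HB Hu.
  assert (H : is_lim_seq (fun n => (B + Cmod (u n - l))%R) (B + 0)%R)
    by (apply is_lim_seq_plus'; [apply is_lim_seq_const|exact Hu]).
  rewrite Rplus_0_r in H.
  apply (is_lim_seq_le (fun _ => Cmod l) _ (Cmod l) B) in H; [exact H| |apply is_lim_seq_const].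
  intros n. replace l with (u n - (u n - l)) at 1 by ring.
  eapply Rle_trans; [apply Cmod_sub_le|]. specialize (HB n). lra.
Qed.

(** * Finite sums, geometric majorants and dominated convergence *)

Fixpoint csum (a : nat -> C) (n : nat) : C :=
  match n with O => 0 | S k => csum a k + a k end.

Lemma csum_sum_n (a : nat -> C) (n : nat) : csum a (S n) = sum_n a n.
Proof.
  induction n as [|n IH].
  - rewrite sum_O. simpl. ring.
  - rewrite sum_Sn, <- IH. reflexivity.
Qed.

Lemma is_series_cv (a : nat -> C) (s : C) : is_series a s <-> cv (csum a) s.
Proof.
  rewrite <- cv_incr, cv_iff_filterlim. unfold is_series.
  split; apply filterlim_ext; intros n; now rewrite csum_sum_n.
Qed.

Lemma csum_ext (a b : nat -> C) (n : nat) :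
  (forall k, (k < n)%nat -> a k = b k) -> csum a n = csum b n.
Proof.
  induction n as [|n IH]; intros H; simpl; [reflexivity|].
  rewrite IH, H by (auto with arith). reflexivity.
Qed.

Lemma csum_plus (a b : nat -> C) (n : nat) :
  csum (fun k => a k + b k) n = csum a n + csum b n.
Proof. induction n as [|n IH]; simpl; [|rewrite IH]; ring. Qed.

Lemma csum_scal (c : C) (a : nat -> C) (n : nat) :
  csum (fun k => c * a k) n = c * csum a n.
Proof. induction n as [|n IH]; simpl; [|rewrite IH]; ring. Qed.

Lemma csum_0 (n : nat) : csum (fun _ => 0) n = 0.
Proof. induction n as [|n IH]; simpl; [|rewrite IH]; ring. Qed.

Lemma csum_add (a : nat -> C) (m n : nat) :
  csum a (m + n) = csum a m + csum (fun k => a (m + k)%nat) n.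
Proof.
  induction n as [|n IH]; [rewrite Nat.add_0_r; simpl; ring|].
  rewrite Nat.add_succ_r; simpl; rewrite IH; ring.
Qed.

Lemma csum_exchange (u : nat -> nat -> C) (m n : nat) :
  csum (fun i => csum (u i) n) m = csum (fun j => csum (fun i => u i j) m) n.
Proof.
  induction m as [|m IH]; simpl; [now rewrite csum_0|].
  now rewrite IH, <- csum_plus.
Qed.

(** Both sides run over the triangle $j+k<n$, by antidiagonals on the left and by rows on the
    right. *)
Lemma csum_triangle (u : nat -> nat -> C) (n : nat) :
  csum (fun i => csum (fun j => u j (i - j)%nat) (S i)) n
  = csum (fun j => csum (u j) (n - j)) n.
Proof.
  induction n as [|n IH]; [reflexivity|].
  transitivity (csum (fun j => csum (u j) (n - j)) n
                + csum (fun j => u j (n - j)%nat) (S n)).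
  { rewrite <- IH. reflexivity. }
  transitivity (csum (fun j => csum (u j) (n - j) + u j (n - j)%nat) (S n)).
  { rewrite csum_plus. simpl. rewrite Nat.sub_diag. simpl. ring. }
  apply csum_ext. intros j Hj. now replace (S n - j)%nat with (S (n - j)) by lia.
Qed.

Lemma csum_telescope (a : nat -> C) (n : nat) :
  csum (fun k => a (S k) - a k) n = a n - a O.
Proof. induction n as [|n IH]; simpl; [|rewrite IH]; ring. Qed.

Lemma csum_Cmod_geom (a : nat -> C) (B r : R) (n : nat) :
  (0 <= r < 1)%R -> (forall k, (Cmod (a k) <= B * r ^ k)%R) ->
  (Cmod (csum a n) <= B / (1 - r))%R.
Proof.
  intros Hr H.
  assert (HB : (0 <= B)%R).
  { specialize (H O). simpl in H. pose proof (Cmod_ge_0 (a O)). lra. }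
  assert (Hn : (Cmod (csum a n) <= B * (1 - r ^ n) / (1 - r))%R).
  { induction n as [|n IH]; simpl.
    - rewrite Cmod_0. right. field. lra.
    - eapply Rle_trans; [apply Cmod_triangle|].
      eapply Rle_trans; [apply Rplus_le_compat; [exact IH|apply H]|].
      right. field. lra. }
  eapply Rle_trans; [exact Hn|]. unfold Rdiv.
  apply Rmult_le_compat_r; [apply Rlt_le, Rinv_0_lt_compat; lra|].
  assert (0 <= r ^ n)%R by (apply pow_le; lra). nra.
Qed.

Lemma csum_tail_geom (a : nat -> C) (B r : R) (m n : nat) :
  (0 <= r < 1)%R -> (forall k, (Cmod (a k) <= B * r ^ k)%R) ->
  (Cmod (csum a (m + n) - csum a m) <= B * r ^ m / (1 - r))%R.
Proof.
  intros Hr H. rewrite csum_add.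
  replace (csum a m + csum (fun k => a (m + k)%nat) n - csum a m)
    with (csum (fun k => a (m + k)%nat) n) by ring.
  apply csum_Cmod_geom; [exact Hr|].
  intros k. rewrite Rmult_assoc, <- pow_add. apply H.
Qed.

Lemma ex_series_geom_le (a : nat -> C) (B r : R) :
  (0 <= r < 1)%R -> (forall k, (Cmod (a k) <= B * r ^ k)%R) ->
  exists s, cv (csum a) s.
Proof.
  intros Hr H.
  destruct (ex_series_le (V := C_CompleteNormedModule) a (fun k => B * r ^ k)%R) as [s Hs].
  - intros n. exact (H n).
  - apply (ex_series_scal_l (V := R_NormedModule) B).
    apply ex_series_geom. rewrite Rabs_pos_eq; lra.
  - exists s. now apply is_series_cv.
Qed.

Lemma series_tail_geom (a : nat -> C) (s : C) (B r : R) (m : nat) :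
  (0 <= r < 1)%R -> (forall k, (Cmod (a k) <= B * r ^ k)%R) -> cv (csum a) s ->
  (Cmod (s - csum a m) <= B * r ^ m / (1 - r))%R.
Proof.
  intros Hr H Hs.
  apply cv_Cmod_le with (fun n => csum a (n + m) - csum a m).
  - intros n. rewrite Nat.add_comm. now apply csum_tail_geom.
  - apply cv_plus; [now apply cv_incr_n|apply cv_const].
Qed.

Lemma is_lim_seq_geom_0 (B r : R) :
  (0 <= r < 1)%R -> is_lim_seq (fun n => (B * r ^ n)%R) 0%R.
Proof.
  intros Hr. replace (Finite 0) with (Finite (B * 0)) by (f_equal; ring).
  apply is_lim_seq_mult'; [apply is_lim_seq_const|].
  apply is_lim_seq_geom. rewrite Rabs_pos_eq; lra.
Qed.

Lemma cv_csum (u : nat -> nat -> C) (l : nat -> C) (n : nat) :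
  (forall k, cv (fun i => u i k) (l k)) -> cv (fun i => csum (u i) n) (csum l n).
Proof.
  intros H. induction n as [|n IH]; simpl; [apply cv_const|].
  now apply cv_plus.
Qed.

(** Geometric domination makes the tails small uniformly in the row [i]; on the remaining finite
    head termwise convergence suffices. *)
Lemma tannery (u : nat -> nat -> C) (l w : nat -> C) (B r : R) :
  (0 <= r < 1)%R ->
  (forall i k, (Cmod (u i k) <= B * r ^ k)%R) ->
  (forall k, cv (fun i => u i k) (l k)) ->
  (forall i, cv (csum (u i)) (w i)) ->
  exists v, cv (csum l) v /\ cv w v.
Proof.
  intros Hr Hu Hl Hw.
  assert (Hlb : forall k, (Cmod (l k) <= B * r ^ k)%R).
  { intros k. now apply cv_Cmod_le with (fun i => u i k). }
  destruct (ex_series_geom_le l B r Hr Hlb) as [v Hv].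
  exists v. split; [exact Hv|].
  unfold cv. apply is_lim_seq_spec. intros eps.
  set (T := (B / (1 - r))%R).
  (* The cut [m] leaves less than $\varepsilon/4$ for the tail of each row and for that of the
     limit; the head of [m] terms gets the other $\varepsilon/2$. *)
  destruct (proj2 (is_lim_seq_spec _ _) (is_lim_seq_geom_0 T r Hr)
              (mkposreal (eps / 4) ltac:(destruct eps; simpl; lra))) as [m Hm].
  specialize (Hm m (le_n _)). simpl in Hm. rewrite Rminus_0_r in Hm.
  apply (Rle_lt_trans _ _ _ (Rle_abs _)) in Hm.
  assert (HT : (B * r ^ m / (1 - r) = T * r ^ m)%R) by (unfold T; field; lra).
  destruct (proj2 (is_lim_seq_spec _ _) (cv_csum u l m Hl)
              (mkposreal (eps / 2) ltac:(destruct eps; simpl; lra))) as [N HN].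
  exists N. intros n Hn. specialize (HN n Hn). simpl in HN.
  rewrite Rminus_0_r, Rabs_pos_eq in HN by apply Cmod_ge_0.
  rewrite Rminus_0_r, Rabs_pos_eq by apply Cmod_ge_0.
  replace (w n - v) with ((w n - csum (u n) m) + (csum (u n) m - csum l m)
                          - (v - csum l m)) by ring.
  eapply Rle_lt_trans; [apply Cmod_sub_le|].
  eapply Rle_lt_trans; [apply Rplus_le_compat_r, Cmod_triangle|].
  assert (H1 := series_tail_geom (u n) (w n) B r m Hr (Hu n) (Hw n)).
  assert (H2 := series_tail_geom l v B r m Hr Hlb Hv).
  destruct eps as [e He]; simpl in *. lra.
Qed.

Lemma csum_truncate (a : nat -> C) (n m : nat) :
  (n <= m)%nat -> csum (fun k => if (k <? n)%nat then a k else 0) m = csum a n.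
Proof.
  intros H. replace m with (n + (m - n))%nat by lia. rewrite csum_add.
  rewrite (csum_ext _ a n).
  - rewrite (csum_ext _ (fun _ => 0) (m - n)); [rewrite csum_0; ring|].
    intros k _. now rewrite (proj2 (Nat.ltb_ge _ _)) by lia.
  - intros k Hk. now rewrite (proj2 (Nat.ltb_lt _ _)) by lia.
Qed.

Lemma cv_eventually_eq (u v : nat -> C) (l : C) (N : nat) :
  (forall n, (N <= n)%nat -> u n = v n) -> cv u l -> cv v l.
Proof.
  intros H Hu. apply (cv_incr_n N). apply (cv_incr_n N) in Hu.
  revert Hu. apply cv_ext. intros n. apply H. lia.
Qed.

(** Replacing row [i] by 0 from index [i] on makes every row a finite sum and does not change the
    termwise limits. Exchanging finite double sums produces exactly this shape, with row and cutoff
    tied together. *)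
Lemma tannery_partial (u : nat -> nat -> C) (l : nat -> C) (B r : R) :
  (0 <= r < 1)%R ->
  (forall i k, (Cmod (u i k) <= B * r ^ k)%R) ->
  (forall k, cv (fun i => u i k) (l k)) ->
  exists v, cv (csum l) v /\ cv (fun n => csum (u n) n) v.
Proof.
  intros Hr Hu Hl.
  apply (tannery (fun i k => if (k <? i)%nat then u i k else 0) l _ B r Hr).
  - intros i k. destruct (k <? i)%nat; [apply Hu|].
    rewrite Cmod_0. eapply Rle_trans; [apply Cmod_ge_0|apply (Hu i k)].
  - intros k. apply cv_eventually_eq with (fun i => u i k) (S k); [|apply Hl].
    intros n Hn. now rewrite (proj2 (Nat.ltb_lt _ _)) by lia.
  - intros i. apply cv_eventually_eq with (fun _ => csum (u i) i) i; [|apply cv_const].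
    intros n Hn. symmetry. now apply csum_truncate.
Qed.

(** * Uniform bounds and convergence for q-Pochhammer symbols *)

Lemma inv_one_minus_le_exp (x r : R) :
  (0 <= x <= r)%R -> (r < 1)%R -> (/ (1 - x) <= exp (x / (1 - r)))%R.
Proof.
  intros Hx Hr.
  apply Rle_trans with (1 + x / (1 - r))%R; [|apply exp_ineq1_le].
  replace (/ (1 - x))%R with (1 + x / (1 - x))%R by (field; lra).
  apply Rplus_le_compat_l. unfold Rdiv. apply Rmult_le_compat_l; [lra|].
  apply Rinv_le_contravar; lra.
Qed.

(** Each factor has modulus at most $1+|q|^k\le\exp(|q|^k)$, and the exponents form a geometric
    series; the induction keeps its exact partial sum. *)
Lemma qpoch_Cmod_le (a q : C) (n : nat) :
  (Cmod q < 1)%R -> (Cmod a <= 1)%R ->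
  (Cmod (qpoch a q n) <= exp (/ (1 - Cmod q)))%R.
Proof.
  intros Hq Ha. pose proof (Cmod_ge_0 q) as Hq0.
  assert (H : (Cmod (qpoch a q n) <= exp ((1 - Cmod q ^ n) / (1 - Cmod q)))%R).
  { induction n as [|n IH]; simpl.
    - rewrite Cmod_1. replace ((1 - 1) / (1 - Cmod q))%R with 0%R by (field; lra).
      rewrite exp_0. lra.
    - replace ((1 - Cmod q * Cmod q ^ n) / (1 - Cmod q))%R
        with ((1 - Cmod q ^ n) / (1 - Cmod q) + Cmod q ^ n)%R by (field; lra).
      rewrite exp_plus, Cmod_mult.
      apply Rmult_le_compat; [apply Cmod_ge_0|apply Cmod_ge_0|exact IH|].
      eapply Rle_trans; [apply Cmod_sub_le|]. rewrite Cmod_1.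
      eapply Rle_trans; [|apply exp_ineq1_le].
      apply Rplus_le_compat_l. rewrite Cmod_mult, Cmod_cpow.
      assert (0 <= Cmod q ^ n)%R by (apply pow_le; lra). nra. }
  eapply Rle_trans; [exact H|].
  assert (Hp : (0 <= Cmod q ^ n)%R) by (apply pow_le; lra).
  assert (Hi : (0 < / (1 - Cmod q))%R) by (apply Rinv_0_lt_compat; lra).
  destruct (Req_dec (Cmod q ^ n) 0) as [H0|H0].
  - rewrite H0. unfold Rdiv. rewrite Rminus_0_r, Rmult_1_l. lra.
  - left. apply exp_increasing. unfold Rdiv. nra.
Qed.

Lemma qpoch_factor_Cmod (a q : C) (n : nat) :
  (Cmod q < 1)%R -> (Cmod a <= Cmod q)%R ->
  (0 <= Cmod q * Cmod q ^ n <= Cmod q)%R /\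
  (1 - Cmod q * Cmod q ^ n <= Cmod (1 - a * cpow q n))%R.
Proof.
  intros Hq Ha. pose proof (Cmod_ge_0 q) as Hq0.
  assert (H0 : (0 <= Cmod q ^ n)%R) by (apply pow_le; lra).
  assert (H1 : (Cmod q ^ n <= 1)%R).
  { apply (pow_le_1_anti (Cmod q) 0 n); [lra|lia]. }
  split; [nra|].
  assert (H := Cmod_triangle (1 - a * cpow q n) (a * cpow q n)).
  replace (1 - a * cpow q n + a * cpow q n) with (RtoC 1) in H by ring.
  rewrite Cmod_1, (Cmod_mult a), Cmod_cpow in H. nra.
Qed.

Lemma qpoch_factor_neq0 (a q : C) (n : nat) :
  (Cmod q < 1)%R -> (Cmod a <= Cmod q)%R -> 1 - a * cpow q n <> 0.
Proof.
  intros Hq Ha H. destruct (qpoch_factor_Cmod a q n Hq Ha) as [H1 H2].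
  rewrite H, Cmod_0 in H2. lra.
Qed.

Lemma qpoch_neq0 (a q : C) (n : nat) :
  (Cmod q < 1)%R -> (Cmod a <= Cmod q)%R -> qpoch a q n <> 0.
Proof.
  intros Hq Ha. induction n as [|n IH]; simpl.
  - exact C1_nz.
  - apply Cmult_neq_0; [exact IH|now apply qpoch_factor_neq0].
Qed.

(** One constant for numerators and denominators. Bounding each $1/(1-r^{k+1})$ by
    $\exp(r^{k+1}/(1-r))$ gives a total exponent below $1/(1-r)^2$, which also dominates the
    exponent $1/(1-r)$ of the direct product. *)
Definition poch_bound (r : R) : R := exp (/ ((1 - r) * (1 - r))).

Lemma poch_bound_pos (r : R) : (0 < poch_bound r)%R.
Proof. apply exp_pos. Qed.

Lemma qpoch_inv_Cmod_le (a q : C) (n : nat) :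
  (Cmod q < 1)%R -> (Cmod a <= Cmod q)%R ->
  (Cmod (/ qpoch a q n) <= poch_bound (Cmod q))%R.
Proof.
  intros Hq Ha. pose proof (Cmod_ge_0 q) as Hq0.
  set (r := Cmod q) in *.
  assert (Hi : (0 < / (1 - r))%R) by (apply Rinv_0_lt_compat; lra).
  assert (H : (Cmod (/ qpoch a q n) <= exp ((1 - r ^ n) * r / ((1 - r) * (1 - r))))%R).
  { induction n as [|n IH].
    - simpl. replace (/ 1) with (RtoC 1) by (field; exact C1_nz). rewrite Cmod_1.
      replace ((1 - 1) * r / ((1 - r) * (1 - r)))%R with 0%R by (field; lra).
      rewrite exp_0. lra.
    - pose proof (qpoch_neq0 a q n Hq Ha) as Hn.
      pose proof (qpoch_factor_neq0 a q n Hq Ha) as Hf.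
      destruct (qpoch_factor_Cmod a q n Hq Ha) as [H1 H2].
      replace (/ qpoch a q (S n)) with (/ qpoch a q n * / (1 - a * cpow q n))
        by (simpl; field; auto).
      replace ((1 - r ^ S n) * r / ((1 - r) * (1 - r)))%R
        with ((1 - r ^ n) * r / ((1 - r) * (1 - r)) + (r * r ^ n) / (1 - r))%R
        by (simpl; field; lra).
      rewrite exp_plus, Cmod_mult.
      apply Rmult_le_compat; [apply Cmod_ge_0|apply Cmod_ge_0|exact IH|].
      eapply Rle_trans; [|apply inv_one_minus_le_exp; [exact H1|exact Hq]].
      rewrite Cmod_inv by exact Hf.
      apply Rinv_le_contravar; [|exact H2]. unfold r in *. lra. }
  eapply Rle_trans; [exact H|]. unfold poch_bound.
  assert (0 <= r ^ n)%R by (apply pow_le; lra).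
  assert (Hlt : ((1 - r ^ n) * r / ((1 - r) * (1 - r)) < / ((1 - r) * (1 - r)))%R).
  { unfold Rdiv. rewrite <- (Rmult_1_l (/ ((1 - r) * (1 - r)))) at 2.
    apply Rmult_lt_compat_r; [apply Rinv_0_lt_compat; nra|nra]. }
  left. now apply exp_increasing.
Qed.

Lemma qpoch_Cmod_le_bound (a q : C) (n : nat) :
  (Cmod q < 1)%R -> (Cmod a <= 1)%R -> (Cmod (qpoch a q n) <= poch_bound (Cmod q))%R.
Proof.
  intros Hq Ha. eapply Rle_trans; [now apply qpoch_Cmod_le|].
  pose proof (Cmod_ge_0 q) as Hq0. unfold poch_bound.
  destruct (Req_dec (Cmod q) 0) as [H0|H0].
  - rewrite H0. right. f_equal. field.
  - left. apply exp_increasing. apply Rinv_lt_contravar; [|nra].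
    apply Rmult_lt_0_compat; nra.
Qed.

(** The increments $-a\,(a;q)_n\,q^n$ are geometrically small, so the telescoping series
    converges. *)
Lemma qpoch_cv (a q : C) :
  (Cmod q < 1)%R -> (Cmod a <= 1)%R -> exists l, cv (qpoch a q) l.
Proof.
  intros Hq Ha. pose proof (Cmod_ge_0 q) as Hq0.
  destruct (ex_series_geom_le (fun n => qpoch a q (S n) - qpoch a q n)
              (poch_bound (Cmod q)) (Cmod q)) as [s Hs]; [lra| |].
  - intros n. simpl.
    replace (qpoch a q n * (1 - a * cpow q n) - qpoch a q n)
      with (- (a * qpoch a q n * cpow q n)) by ring.
    rewrite Cmod_opp, !Cmod_mult, Cmod_cpow.
    apply Rmult_le_compat_r; [apply pow_le; lra|].
    pose proof (qpoch_Cmod_le_bound a q n Hq Ha). pose proof (Cmod_ge_0 a).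
    pose proof (Cmod_ge_0 (qpoch a q n)). nra.
  - exists (s + 1).
    apply cv_ext with (fun n => csum (fun n => qpoch a q (S n) - qpoch a q n) n + 1).
    + intros n. rewrite csum_telescope. simpl. ring.
    + apply cv_plus; [exact Hs|apply cv_const].
Qed.

(** If the limit were 0, the constant $1=(a;q)_n^{-1}(a;q)_n$ would be a bounded sequence times a
    null sequence. *)
Lemma qpoch_lim_neq0 (a q l : C) :
  (Cmod q < 1)%R -> (Cmod a <= Cmod q)%R -> cv (qpoch a q) l -> l <> 0.
Proof.
  intros Hq Ha Hl H0. subst l. apply C1_nz.
  apply (cv_unique (fun _ => 1) 1 0); [apply cv_const|].
  apply cv_le with (fun n => (poch_bound (Cmod q) * Cmod (qpoch a q n - 0))%R).
  - intros n. replace (1 - 0) with (/ qpoch a q n * (qpoch a q n - 0))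
      by (field; now apply qpoch_neq0).
    rewrite Cmod_mult. apply Rmult_le_compat_r; [apply Cmod_ge_0|].
    now apply qpoch_inv_Cmod_le.
  - replace (Finite 0) with (Finite (poch_bound (Cmod q) * 0)) by (f_equal; ring).
    apply is_lim_seq_mult'; [apply is_lim_seq_const|exact Hl].
Qed.

Lemma cv_cpow_0 (q : C) : (Cmod q < 1)%R -> cv (cpow q) 0.
Proof.
  intros Hq. pose proof (Cmod_ge_0 q).
  apply cv_le with (fun n => (1 * Cmod q ^ n)%R).
  - intros n. replace (cpow q n - 0) with (cpow q n) by ring. rewrite Cmod_cpow. lra.
  - apply is_lim_seq_geom_0. lra.
Qed.

(** * The conjugate Bailey pair *)

(** The term $n=s+m$ of the series $\sum_n q^n[2n;n+s]/(-q;q)_n$, already divided by $q^s$. Here [q]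
    stands for the $Q$ of the overview. *)
Definition gam (q : C) (s m : nat) : C :=
  cpow q m * qpoch q q (2 * s + 2 * m)
    / (qpoch q q (2 * s + m) * qpoch q q m * qpoch (- q) q (m + s)).

(* The polynomial factor was found by solving the linear system for its
   coefficients, as in Gosper's algorithm. *)
Definition gam_cert (q : C) (s m : nat) : C :=
  let z := cpow q s in let M := cpow q m in
  qpoch q q (2 * s + 2 * m) * (1 - M)
    * (1 + z * q - z * z * q * q * (1 + q) * M - z * z * z * q * q * M * M
       + z * z * z * z * z * z * q * q * q * q * q * q * M * M * M * M)
    / (qpoch q q (2 * s + m + 3) * qpoch q q m * qpoch (- q) q (m + s)).

(** Once all Pochhammer symbols are reduced to four common ones, their lengths differing by at most
    four factors, what remains is a rational identity in $q$, $z=q^s$ and $M=q^m$, which [field]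
    decides. *)
Lemma gam_telescope (q : C) (s m : nat) :
  (Cmod q < 1)%R ->
  gam q s m + cpow q (3 * s + 5) * gam q (s + 2) m
  = gam_cert q s (S m) - gam_cert q s m.
Proof.
  intros Hq.
  assert (Hq' : (Cmod q <= Cmod q)%R) by lra.
  assert (Hq'' : (Cmod (- q) <= Cmod q)%R) by (rewrite Cmod_opp; lra).
  unfold gam, gam_cert.
  replace (2 * (s + 2) + 2 * m)%nat with (S (S (S (S (2 * s + 2 * m))))) by lia.
  replace (2 * (s + 2) + m)%nat with (S (S (S (S (2 * s + m))))) by lia.
  replace (m + (s + 2))%nat with (S (S (m + s))) by lia.
  replace (2 * s + 2 * S m)%nat with (S (S (2 * s + 2 * m))) by lia.
  replace (2 * s + S m + 3)%nat with (S (S (S (S (2 * s + m))))) by lia.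
  replace (2 * s + m + 3)%nat with (S (S (S (2 * s + m)))) by lia.
  replace (S m + s)%nat with (S (m + s)) by lia.
  replace (3 * s + 5)%nat with (s + (s + (s + 5)))%nat by lia.
  pose proof (qpoch_neq0 q q (2 * s + m) Hq Hq') as N1.
  pose proof (qpoch_neq0 q q m Hq Hq') as N2.
  pose proof (qpoch_neq0 (- q) q (m + s) Hq Hq'') as N3.
  pose proof (qpoch_factor_neq0 q q m Hq Hq') as N4.
  pose proof (qpoch_factor_neq0 (- q) q (m + s) Hq Hq'') as N5.
  pose proof (qpoch_factor_neq0 (- q) q (S (m + s)) Hq Hq'') as N6.
  pose proof (qpoch_factor_neq0 q q (2 * s + m) Hq Hq') as N7.
  pose proof (qpoch_factor_neq0 q q (S (2 * s + m)) Hq Hq') as N8.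
  pose proof (qpoch_factor_neq0 q q (S (S (2 * s + m))) Hq Hq') as N9.
  pose proof (qpoch_factor_neq0 q q (S (S (S (2 * s + m)))) Hq Hq') as N10.
  cbn [qpoch cpow].
  cbn [cpow] in N4, N5, N6, N7, N8, N9, N10.
  replace (2 * s + 2 * m)%nat with (s + (s + (m + m)))%nat in * by lia.
  replace (2 * s + m)%nat with (s + (s + m))%nat in * by lia.
  rewrite !cpow_add in *. cbn [cpow].
  generalize dependent (qpoch q q (s + (s + (m + m)))).
  generalize dependent (qpoch q q (s + (s + m))).
  generalize dependent (qpoch q q m).
  generalize dependent (qpoch (- q) q (m + s)).
  generalize dependent (cpow q s). generalize dependent (cpow q m).
  intros M z N4 N5 N6 N7 N8 N9 N10 e He f2 Hf2 f1 Hf1 f0.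
  field. repeat split; auto.
Qed.

(** A total limit operator, taken coordinatewise, so that [Gam] can be a function of [s]; its value
    is meaningful only for convergent sequences. *)
Definition Clim (u : nat -> C) : C :=
  (real (Lim_seq (fun n => Re (u n))), real (Lim_seq (fun n => Im (u n)))).

Lemma Clim_cv (u : nat -> C) : (exists l, cv u l) -> cv u (Clim u).
Proof.
  intros [l Hl].
  (* [p] stands for [Re] and [Im] alike; being additive and bounded by the modulus is all that is
     used. *)
  assert (H : forall (p : C -> R), (forall x, (Rabs (p x) <= Cmod x)%R) ->
    (forall x y : C, p (x - y)%C = (p x - p y)%R) -> real (Lim_seq (fun n => p (u n))) = p l).
  { intros p Hp Hs.
    replace (p l) with (real (p l)) by reflexivity. f_equal. apply is_lim_seq_unique.
    assert (H0 : is_lim_seq (fun n => p (u n) - p l)%R 0%R).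
    { apply is_lim_seq_abs_0.
      apply is_lim_seq_le_le with (fun _ => 0%R) (fun n => Cmod (u n - l)).
      - intros n. split; [apply Rabs_pos|]. rewrite <- Hs. apply Hp.
      - apply is_lim_seq_const.
      - exact Hl. }
    replace (Finite (p l)) with (Finite (0 + p l)) by (f_equal; ring).
    apply is_lim_seq_ext with (fun n => (p (u n) - p l) + p l)%R; [intros; ring|].
    apply is_lim_seq_plus'; [exact H0|apply is_lim_seq_const]. }
  replace (Clim u) with l; [exact Hl|].
  unfold Clim. rewrite (H Re), (H Im).
  - now destruct l.
  - intros x. eapply Rle_trans; [|apply Rmax_Cmod]. apply Rmax_r.
  - reflexivity.
  - apply re_le_Cmod.
  - reflexivity.
Qed.

Lemma Cmod_mult_le (x y : C) (A B : R) :
  (Cmod x <= A)%R -> (Cmod y <= B)%R -> (Cmod (x * y) <= A * B)%R.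
Proof.
  intros. rewrite Cmod_mult. apply Rmult_le_compat; auto using Cmod_ge_0.
Qed.

Lemma Cmod_cpow_le1 (q : C) (n : nat) : (Cmod q < 1)%R -> (Cmod (cpow q n) <= 1)%R.
Proof.
  intros Hq. rewrite Cmod_cpow. apply (pow_le_1_anti _ 0 n); [|lia].
  pose proof (Cmod_ge_0 q). lra.
Qed.

Lemma Cmod_cpow_le (q : C) (m n : nat) :
  (Cmod q < 1)%R -> (m <= n)%nat -> (Cmod (cpow q n) <= Cmod q ^ m)%R.
Proof.
  intros Hq H. rewrite Cmod_cpow. apply pow_le_1_anti; [|exact H].
  pose proof (Cmod_ge_0 q). lra.
Qed.

(** One factor [poch_bound] for each of the four Pochhammer symbols. That the bound does not depend
    on [s] is what the iteration needs later, where [s] drifts to infinity. *)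
Lemma gam_Cmod_le (q : C) (s m : nat) :
  (Cmod q < 1)%R -> (Cmod (gam q s m) <= poch_bound (Cmod q) ^ 4 * Cmod q ^ m)%R.
Proof.
  intros Hq. set (K := poch_bound (Cmod q)).
  assert (Hq' : (Cmod q <= Cmod q)%R) by lra.
  assert (Hq'' : (Cmod (- q) <= Cmod q)%R) by (rewrite Cmod_opp; lra).
  unfold gam.
  replace (_ / _) with (cpow q m * (qpoch q q (2 * s + 2 * m) * (/ qpoch q q (2 * s + m)
    * (/ qpoch q q m * / qpoch (- q) q (m + s)))))
    by (field; repeat split; now apply qpoch_neq0).
  replace (K ^ 4 * Cmod q ^ m)%R with (Cmod q ^ m * (K * (K * (K * K))))%R by ring.
  apply Cmod_mult_le; [rewrite Cmod_cpow; lra|].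
  apply Cmod_mult_le; [apply qpoch_Cmod_le_bound; lra|].
  repeat apply Cmod_mult_le; now apply qpoch_inv_Cmod_le.
Qed.

Definition Gam (q : C) (s : nat) : C := Clim (csum (gam q s)).

Lemma Gam_cv (q : C) (s : nat) : (Cmod q < 1)%R -> cv (csum (gam q s)) (Gam q s).
Proof.
  intros Hq. apply Clim_cv.
  apply ex_series_geom_le with (poch_bound (Cmod q) ^ 4)%R (Cmod q).
  - pose proof (Cmod_ge_0 q). lra.
  - intros k. now apply gam_Cmod_le.
Qed.

(** Summing the telescoping identity leaves two boundary terms. At $m=0$ the certificate vanishes
    through its factor $1-M$; as $M=q^m\to0$ only the constant part $1+zq$ of its polynomial
    survives, and the Pochhammer symbols tend to $f/(f\cdot f\cdot e)$. Multiplying by $fe$ leaves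
    $1+q^{s+1}$. *)
Lemma Gam_functional_eq (q f e : C) (s : nat) :
  (Cmod q < 1)%R -> cv (qpoch q q) f -> cv (qpoch (- q) q) e ->
  f * e * Gam q s = 1 + cpow q (s + 1) - cpow q (3 * s + 5) * (f * e * Gam q (s + 2)).
Proof.
  intros Hq Hf He.
  assert (Hq' : (Cmod q <= Cmod q)%R) by lra.
  assert (Hq'' : (Cmod (- q) <= Cmod q)%R) by (rewrite Cmod_opp; lra).
  assert (Nf : f <> 0) by now apply (qpoch_lim_neq0 q q).
  assert (Ne : e <> 0) by now apply (qpoch_lim_neq0 (- q) q).
  assert (HM := cv_cpow_0 q Hq).
  assert (Hsub : forall (u : nat -> C) (l : C) (g : nat -> nat),
    (forall n, (n <= g n)%nat) -> cv u l -> cv (fun n => u (g n)) l).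
  { intros u l g Hg Hu. unfold cv. apply (is_lim_seq_subseq (fun n => Cmod (u n - l)) _ g).
    - 
      intros P [N HN]. exists N. intros n Hn. apply HN. specialize (Hg n). lia.
    - exact Hu. }
  assert (Hinv : forall (a : C) (g : nat -> nat) (l : C), (Cmod a <= Cmod q)%R -> l <> 0 ->
    (forall n, (n <= g n)%nat) -> cv (qpoch a q) l ->
    cv (fun n => / qpoch a q (g n)) (/ l)).
  { intros a g l Ha Hl Hg Hu. apply cv_inv with (poch_bound (Cmod q)); auto.
    - intros n. now apply qpoch_neq0.
    - intros n. now apply qpoch_inv_Cmod_le. }
  set (z := cpow q s).
  assert (HX : cv (fun m => 1 + z * q - z * z * q * q * (1 + q) * cpow q m
       + (- (z * z * z * q * q)) * (cpow q m * cpow q m)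
       + z * z * z * z * z * z * q * q * q * q * q * q
         * (cpow q m * cpow q m * (cpow q m * cpow q m)))
     (1 + z * q)).
  { replace (1 + z * q) with (1 + z * q + - (z * z * q * q * (1 + q)) * 0
      + (- (z * z * z * q * q)) * (0 * 0)
      + z * z * z * z * z * z * q * q * q * q * q * q * (0 * 0 * (0 * 0))) at 1 by ring.
    apply cv_plus; [apply cv_plus; [|apply cv_scal; now apply cv_mult]|].
    - apply cv_ext with (fun m => 1 + z * q + - (z * z * q * q * (1 + q)) * cpow q m);
        [intros; ring|].
      apply cv_plus; [apply cv_const|now apply cv_scal].
    - apply cv_scal. apply cv_mult; now apply cv_mult. }
  assert (HD : cv (gam_cert q s) (f * ((1 + (-1) * 0) * (1 + z * q)) * (/ f * (/ f * / e)))).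
  { apply cv_ext with (fun m => qpoch q q (2 * s + 2 * m) * ((1 + (-1) * cpow q m) *
      (1 + z * q - z * z * q * q * (1 + q) * cpow q m
       + (- (z * z * z * q * q)) * (cpow q m * cpow q m)
       + z * z * z * z * z * z * q * q * q * q * q * q
         * (cpow q m * cpow q m * (cpow q m * cpow q m))))
      * (/ qpoch q q (2 * s + m + 3) * (/ qpoch q q m * / qpoch (- q) q (m + s)))).
    - intros m. unfold gam_cert. cbv zeta. fold z.
      field. repeat split; now apply qpoch_neq0.
    - apply cv_mult; [apply cv_mult|apply cv_mult; [|apply cv_mult]].
      + apply (Hsub _ _ (fun m => 2 * s + 2 * m)%nat); [intros; lia|exact Hf].
      + apply cv_mult; [|exact HX].
        apply cv_plus; [apply cv_const|now apply cv_scal].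
      + apply (Hinv q (fun m => 2 * s + m + 3)%nat); auto. intros; lia.
      + apply (Hinv q (fun m => m)); auto.
      + apply (Hinv (- q) (fun m => m + s)%nat); auto. intros; lia. }
  assert (HS : cv (csum (fun m => gam_cert q s (S m) - gam_cert q s m))
                 (Gam q s + cpow q (3 * s + 5) * Gam q (s + 2))).
  { apply cv_ext with (fun n => csum (gam q s) n
       + cpow q (3 * s + 5) * csum (gam q (s + 2)) n).
    - intros n. rewrite <- csum_scal, <- csum_plus. apply csum_ext.
      intros k _. now apply gam_telescope.
    - apply cv_plus; [now apply Gam_cv|apply cv_scal; now apply Gam_cv]. }
  assert (HE : Gam q s + cpow q (3 * s + 5) * Gam q (s + 2)
               = f * ((1 + (-1) * 0) * (1 + z * q)) * (/ f * (/ f * / e))).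
  { apply (cv_unique _ _ _ HS). revert HD. apply cv_ext. intros n.
    rewrite csum_telescope. unfold gam_cert. simpl. unfold Cdiv. ring. }
  replace (f * e * Gam q s)
    with (f * e * (Gam q s + cpow q (3 * s + 5) * Gam q (s + 2))
          - cpow q (3 * s + 5) * (f * e * Gam q (s + 2))) by ring.
  rewrite HE, (cpow_add q s 1). fold z. cbn [cpow]. field. auto.
Qed.

(** * Iteration of the functional equation *)

Definition hecke_term (q : C) (s k : nat) : C :=
  cpow (-1) k * (cpow q (3 * k * k + 2 * k + 3 * k * s) * (1 + cpow q (2 * k + 1 + s))).

Lemma Cmod_cpow_m1 (k : nat) : Cmod (cpow (-1) k) = 1%R.
Proof.
  rewrite Cmod_cpow. replace (Cmod (-1)) with 1%R; [apply pow1|].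
  rewrite <- Cmod_1, <- Cmod_opp. f_equal.
  unfold RtoC, Copp. simpl. f_equal; ring.
Qed.

(** After [k] substitutions the remainder is known exactly: up to sign, $q^{3k^2+2k+3ks}\,G(s+2k)$.
    The next substitution raises the exponent by $3(s+2k)+5$. As [G] is bounded and the exponent is
    at least $k$, the remainder is at most $B|q|^k$. *)
Lemma hecke_iterate (q : C) (G : nat -> C) (B : R) (s : nat) :
  (Cmod q < 1)%R -> (forall s, (Cmod (G s) <= B)%R) ->
  (forall s, G s = 1 + cpow q (s + 1) - cpow q (3 * s + 5) * G (s + 2)%nat) ->
  cv (csum (hecke_term q s)) (G s).
Proof.
  intros Hq HB HG. pose proof (Cmod_ge_0 q).
  assert (HB0 : (0 <= B)%R) by (eapply Rle_trans; [apply Cmod_ge_0|apply (HB O)]).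
  assert (H1 : forall k, csum (hecke_term q s) k - G s
    = - (cpow (-1) k * (cpow q (3 * k * k + 2 * k + 3 * k * s) * G (s + 2 * k)%nat))).
  { induction k as [|k IH].
    - simpl. rewrite Nat.add_0_r. ring.
    - simpl csum.
      replace (csum (hecke_term q s) k + hecke_term q s k - G s)
        with (csum (hecke_term q s) k - G s + hecke_term q s k) by ring.
      rewrite IH, (HG (s + 2 * k)%nat). unfold hecke_term.
      replace (3 * S k * S k + 2 * S k + 3 * S k * s)%nat
        with ((3 * k * k + 2 * k + 3 * k * s) + (3 * (s + 2 * k) + 5))%nat by lia.
      replace (s + 2 * S k)%nat with (s + 2 * k + 2)%nat by lia.
      replace (2 * k + 1 + s)%nat with (s + 2 * k + 1)%nat by lia.
      rewrite (cpow_add q (3 * k * k + 2 * k + 3 * k * s)). cbn [cpow]. ring. }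
  apply cv_le with (fun k => (B * Cmod q ^ k)%R); [|apply is_lim_seq_geom_0; lra].
  intros k. rewrite H1, Cmod_opp, !Cmod_mult, Cmod_cpow_m1, Rmult_1_l, Rmult_comm.
  apply Rmult_le_compat; try apply Cmod_ge_0; [apply HB|].
  apply Cmod_cpow_le; [exact Hq|lia].
Qed.

Lemma Gam_series (q f e : C) (s : nat) :
  (Cmod q < 1)%R -> cv (qpoch q q) f -> cv (qpoch (- q) q) e ->
  cv (csum (hecke_term q s)) (f * e * Gam q s).
Proof.
  intros Hq Hf He.
  apply (hecke_iterate q (fun s => f * e * Gam q s)
    (Cmod (f * e) * (poch_bound (Cmod q) ^ 4 / (1 - Cmod q)))%R); [exact Hq| |].
  - intros t. apply Cmod_mult_le; [lra|].
    apply cv_Cmod_le with (csum (gam q t)); [|now apply Gam_cv].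
    intros n. apply csum_Cmod_geom; [pose proof (Cmod_ge_0 q); lra|].
    intros k. now apply gam_Cmod_le.
  - intros t. now apply Gam_functional_eq.
Qed.

Lemma cpow_Cmult (x y : C) (n : nat) : cpow (x * y) n = cpow x n * cpow y n.
Proof. induction n as [|n IH]; simpl; [|rewrite IH]; ring. Qed.

Lemma Cmod_square_lt1 (q : C) : (Cmod q < 1)%R -> (Cmod (q * q) < 1)%R.
Proof. intros Hq. rewrite Cmod_mult. pose proof (Cmod_ge_0 q). nra. Qed.

(** * Finite Jacobi triple product *)

(* The Gaussian binomial coefficient [2n; n+s]. *)
Definition qbin (q : C) (n s : nat) : C :=
  if (s <=? n)%nat
  then qpoch q q (2 * n) / (qpoch q q (n - s) * qpoch q q (n + s))
  else 0.

Lemma qbin_small (q : C) (n s : nat) : (n < s)%nat -> qbin q n s = 0.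
Proof. intros H. unfold qbin. now rewrite (proj2 (Nat.leb_gt s n) H). Qed.

Lemma qbin_add (q : C) (s d : nat) :
  qbin q (s + d) s = qpoch q q (2 * s + 2 * d) / (qpoch q q d * qpoch q q (2 * s + d)).
Proof.
  unfold qbin. rewrite (proj2 (Nat.leb_le s (s + d))) by lia.
  replace (s + d - s)%nat with d by lia.
  replace (2 * (s + d))%nat with (2 * s + 2 * d)%nat by lia.
  now replace (s + d + s)%nat with (2 * s + d)%nat by lia.
Qed.

(** The q-Pascal rule applied twice, passing from $2n$ to $2n+2$. It is verified by clearing the
    common Pochhammer symbols. *)
Lemma qbin_rec (q : C) (n s : nat) : (Cmod q < 1)%R ->
  qbin q (S n) (S s) = (1 + cpow q (2 * n + 1)) * qbin q n (S s)
    + cpow q (n - s) * qbin q n s + cpow q (n + s + 2) * qbin q n (S (S s)).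
Proof.
  intros Hq. assert (Hq' : (Cmod q <= Cmod q)%R) by lra.
  assert (N := fun k => qpoch_neq0 q q k Hq Hq').
  assert (F := fun k => qpoch_factor_neq0 q q k Hq Hq').
  destruct (le_lt_dec s n) as [H|H].
  (* For $s>n$ every binomial vanishes, so the truncated [n - s] is harmless. *)
  2: { rewrite !qbin_small by lia. ring. }
  remember (n - s)%nat as d eqn:Hd.
  assert (Hn : n = (s + d)%nat) by lia. clear Hd H. subst n.
  replace (S (s + d)) with (S s + d)%nat by lia. rewrite !qbin_add.
  (* With $n=s+d$, two of the binomials on the right are out of range and 0 by convention when
     $d=0$, and one of them when $d=1$. *)
  destruct d as [|[|d]].
  - rewrite !qbin_small by lia.
    replace (2 * s + 2 * 0)%nat with (2 * s)%nat by lia.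
    replace (2 * s + 0)%nat with (2 * s)%nat by lia.
    replace (2 * S s + 2 * 0)%nat with (2 * S s)%nat by lia.
    replace (2 * S s + 0)%nat with (2 * S s)%nat by lia.
    pose proof (N (2 * s)%nat). pose proof (N (2 * S s)%nat).
    cbn [cpow]. cbn [qpoch]. field. split; auto; exact C1_nz.
  - rewrite (qbin_small _ _ (S (S s))) by lia.
    replace (qbin q (s + 1) (S s)) with (qbin q (S s + 0) (S s)) by (f_equal; lia). rewrite qbin_add.
    replace (2 * S s + 2 * 1)%nat with (S (S (S (S (2 * s))))) by lia.
    replace (2 * S s + 1)%nat with (S (S (S (2 * s)))) by lia.
    replace (2 * S s + 2 * 0)%nat with (S (S (2 * s))) by lia.
    replace (2 * S s + 0)%nat with (S (S (2 * s))) by lia.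
    replace (2 * s + 2 * 1)%nat with (S (S (2 * s))) by lia.
    replace (2 * s + 1)%nat with (S (2 * s)) by lia.
    replace (2 * (s + 1) + 1)%nat with (S (S (S (2 * s)))) by lia.
    pose proof (N (2 * s)%nat) as N0.
    assert (F0 : 1 - q <> 0) by (rewrite <- (Cmult_1_r q) at 1; apply (F O)).
    pose proof (F (2 * s)%nat) as F1. pose proof (F (S (2 * s))) as F2.
    pose proof (F (S (S (2 * s)))) as F3.
    cbn [cpow] in *. cbn [qpoch cpow].
    generalize dependent (qpoch q q (2 * s)). generalize dependent (cpow q (2 * s)).
    intros. field. repeat split; auto.
  - replace (qbin q (s + S (S d)) (S s)) with (qbin q (S s + S d) (S s)) by (f_equal; lia).
    replace (qbin q (s + S (S d)) (S (S s))) with (qbin q (S (S s) + d) (S (S s)))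
      by (f_equal; lia).
    rewrite !qbin_add.
    replace (2 * S s + 2 * S (S d))%nat with (S (S (S (S (S (S (2 * s + 2 * d))))))) by lia.
    replace (2 * S s + S (S d))%nat with (S (S (S (S (2 * s + d))))) by lia.
    replace (2 * S s + 2 * S d)%nat with (S (S (S (S (2 * s + 2 * d))))) by lia.
    replace (2 * S s + S d)%nat with (S (S (S (2 * s + d)))) by lia.
    replace (2 * s + 2 * S (S d))%nat with (S (S (S (S (2 * s + 2 * d))))) by lia.
    replace (2 * s + S (S d))%nat with (S (S (2 * s + d))) by lia.
    replace (2 * S (S s) + 2 * d)%nat with (S (S (S (S (2 * s + 2 * d))))) by lia.
    replace (2 * S (S s) + d)%nat with (S (S (S (S (2 * s + d))))) by lia.
    replace (2 * (s + S (S d)) + 1)%nat with (S (S (S (S (S (2 * s + 2 * d)))))) by lia.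
    replace (s + S (S d) + s + 2)%nat with (S (S (S (S (2 * s + d))))) by lia.
    pose proof (N (2 * s + d)%nat) as N0. pose proof (N d) as N1.
    pose proof (F d) as F0. pose proof (F (S d)) as F0'.
    pose proof (F (2 * s + d)%nat) as F1. pose proof (F (S (2 * s + d))) as F2.
    pose proof (F (S (S (2 * s + d)))) as F3. pose proof (F (S (S (S (2 * s + d))))) as F4.
    cbn [cpow] in *. cbn [qpoch cpow].
    replace (2 * s + 2 * d)%nat with (s + (s + (d + d)))%nat in * by lia.
    replace (2 * s + d)%nat with (s + (s + d))%nat in * by lia.
    rewrite !cpow_add in *.
    generalize dependent (qpoch q q (s + (s + (d + d)))).
    generalize dependent (qpoch q q (s + (s + d))).
    generalize dependent (qpoch q q d).
    generalize dependent (cpow q s). generalize dependent (cpow q d).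
    intros. field. repeat split; auto.
Qed.

(** At the centre the neighbours $[2n;n-1]$ and $[2n;n+1]$ coincide, hence the factor 2. *)
Lemma qbin_rec_0 (q : C) (n : nat) : (Cmod q < 1)%R ->
  qbin q (S n) 0 = (1 + cpow q (2 * n + 1)) * qbin q n 0
    + 2 * (cpow q (n + 1) * qbin q n 1).
Proof.
  intros Hq. assert (Hq' : (Cmod q <= Cmod q)%R) by lra.
  assert (N := fun k => qpoch_neq0 q q k Hq Hq').
  assert (F := fun k => qpoch_factor_neq0 q q k Hq Hq').
  replace (qbin q (S n) 0) with (qbin q (0 + S n) 0) by reflexivity.
  replace (qbin q n 0) with (qbin q (0 + n) 0) by reflexivity.
  rewrite !qbin_add.
  destruct n as [|n].
  - rewrite qbin_small by lia. assert (F0 : 1 - q <> 0) by (rewrite <- (Cmult_1_r q) at 1; apply (F O)).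
    cbn. field.
    repeat split; auto; try exact C1_nz.
  - replace (qbin q (S n) 1) with (qbin q (1 + n) 1) by reflexivity. rewrite qbin_add.
    replace (2 * 0 + 2 * S (S n))%nat with (S (S (S (S (2 * n))))) by lia.
    replace (2 * 0 + S (S n))%nat with (S (S n)) by lia.
    replace (2 * 0 + 2 * S n)%nat with (S (S (2 * n))) by lia.
    replace (2 * 0 + S n)%nat with (S n) by lia.
    replace (2 * 1 + 2 * n)%nat with (S (S (2 * n))) by lia.
    replace (2 * 1 + n)%nat with (S (S n)) by lia.
    replace (2 * S n + 1)%nat with (S (S (S (2 * n)))) by lia.
    replace (S n + 1)%nat with (S (S n)) by lia.
    pose proof (N n) as N0. pose proof (F n) as F0. pose proof (F (S n)) as F1.
    cbn [cpow] in *. cbn [qpoch cpow].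
    replace (2 * n)%nat with (n + n)%nat in * by lia.
    rewrite !cpow_add in *.
    generalize dependent (qpoch q q (n + n)).
    generalize dependent (qpoch q q n). generalize dependent (cpow q n).
    intros. field. repeat split; auto.
Qed.

(* [symsum y N] is the sum of [y |j|] over all integers [|j| <= N]. *)
Definition sym_weight (j : nat) : C := match j with O => 1 | _ => 2 end.
Definition symsum (y : nat -> C) (N : nat) : C :=
  csum (fun j => sym_weight j * y j) (S N).

Lemma symsum_0 (y : nat -> C) : symsum y 0 = y O.
Proof. unfold symsum. simpl. ring. Qed.

Lemma symsum_S (y : nat -> C) (N : nat) : symsum y (S N) = symsum y N + 2 * y (S N).
Proof. reflexivity. Qed.

Lemma symsum_ext (x y : nat -> C) (N : nat) :
  (forall j, (j <= N)%nat -> x j = y j) -> symsum x N = symsum y N.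
Proof.
  intros H. apply csum_ext. intros j Hj. rewrite H; [reflexivity|lia].
Qed.

(** Summing $y_{j-1}+y_{j+1}$ over $|j|\le N$ gives twice the sum of $y$, up to the terms at the two
    ends of the window. *)
Lemma symsum_three_term (y y' : nat -> C) (a b : C) (N : nat) :
  y' O = a * y O - 2 * (b * y 1%nat) ->
  (forall s, y' (S s) = a * y (S s) - b * (y s + y (S (S s)))) ->
  symsum y' N = (a - 2 * b) * symsum y N + 2 * (b * (y N - y (S N))).
Proof.
  intros H0 HS. induction N as [|N IH].
  - rewrite !symsum_0, H0. ring.
  - rewrite !symsum_S, IH, HS. ring.
Qed.

(** Odd indices cancel and even ones double. The range [2 * N] is what leaves $|j|\le N$ after
    $s=2j$. *)
Lemma symsum_even_part (y : nat -> C) (N : nat) :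
  symsum y (2 * N) + symsum (fun s => cpow (-1) s * y s) (2 * N)
  = 2 * symsum (fun j => y (2 * j)%nat) N.
Proof.
  induction N as [|N IH].
  - simpl. rewrite !symsum_0. simpl. ring.
  - replace (2 * S N)%nat with (S (S (2 * N))) by lia.
    rewrite !symsum_S. replace (2 * S N)%nat with (S (S (2 * N))) by lia.
    cbn [cpow]. rewrite cpow_m1_double.
    transitivity (symsum y (2 * N) + symsum (fun s => cpow (-1) s * y s) (2 * N)
                  + 4 * y (S (S (2 * N)))); [ring|].
    rewrite IH. ring.
Qed.

(** The coefficient of $z^s$, equally of $z^{-s}$, in
    $\prod_{k<n}(1-zq^{2k+1})(1-z^{-1}q^{2k+1})$. *)
Definition theta_coef (q : C) (n s : nat) : C :=
  cpow (-1) s * (cpow q (s * s) * qbin (q * q) n s).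

(** This is multiplication by $(1-zq^{2n+1})(1-z^{-1}q^{2n+1})$. The powers match because
    $(s+1)^2+2(n-s)=2n+1+s^2$ and $(s+1)^2+2(n+s+2)=2n+1+(s+2)^2$. *)
Lemma theta_coef_rec (q : C) (n s : nat) : (Cmod q < 1)%R ->
  theta_coef q (S n) (S s) = (1 + cpow q (2 * (2 * n + 1))) * theta_coef q n (S s)
    - cpow q (2 * n + 1) * (theta_coef q n s + theta_coef q n (S (S s))).
Proof.
  intros Hq. unfold theta_coef. rewrite qbin_rec by now apply Cmod_square_lt1.
  rewrite !(cpow_Cmult q q), <- !cpow_add.
  destruct (le_lt_dec s n) as [H|H].
  - replace (2 * (2 * n + 1))%nat with (2 * n + 1 + (2 * n + 1))%nat by lia.
    replace (cpow (-1) (S s)) with (- cpow (-1) s) by (simpl; ring).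
    replace (cpow (-1) (S (S s))) with (cpow (-1) s) by (simpl; ring).
    transitivity ((1 + cpow q (2 * n + 1 + (2 * n + 1))) * (- cpow (-1) s *
       (cpow q (S s * S s) * qbin (q * q) n (S s)))
      - cpow (-1) s * ((cpow q (S s * S s) * cpow q (n - s + (n - s))) * qbin (q * q) n s
        + (cpow q (S s * S s) * cpow q (n + s + 2 + (n + s + 2)))
          * qbin (q * q) n (S (S s)))); [ring|].
    rewrite <- !(cpow_add q (S s * S s)).
    replace (S s * S s + (n - s + (n - s)))%nat with (2 * n + 1 + s * s)%nat by lia.
    replace (S s * S s + (n + s + 2 + (n + s + 2)))%nat
      with (2 * n + 1 + S (S s) * S (S s))%nat by lia.
    rewrite (cpow_add q (2 * n + 1) (s * s)), (cpow_add q (2 * n + 1) (S (S s) * S (S s))).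
    ring.
  - rewrite !qbin_small by lia. ring.
Qed.

Lemma theta_coef_rec_0 (q : C) (n : nat) : (Cmod q < 1)%R ->
  theta_coef q (S n) 0 = (1 + cpow q (2 * (2 * n + 1))) * theta_coef q n 0
    - 2 * (cpow q (2 * n + 1) * theta_coef q n 1).
Proof.
  intros Hq. unfold theta_coef. rewrite qbin_rec_0 by now apply Cmod_square_lt1.
  rewrite !(cpow_Cmult q q), <- !cpow_add.
  replace (2 * (2 * n + 1))%nat with (2 * n + 1 + (2 * n + 1))%nat by lia.
  replace (n + 1 + (n + 1))%nat with (2 * n + 1 + 1)%nat by lia.
  rewrite (cpow_add q (2 * n + 1) 1). 
  change (0 * 0)%nat with O. change (1 * 1)%nat with 1%nat. cbn [cpow]. ring.
Qed.

(** The triple product at $z=1$, where the recurrence multiplies the sum by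
    $1+q^{4n+2}-2q^{2n+1}=(1-q^{2n+1})^2$ and the end terms vanish, being out of range. The free
    cutoff [N] lets all terms of a partial sum of $S$ share one range of $j$. *)
Lemma finite_triple_product (q : C) (n N : nat) : (Cmod q < 1)%R -> (n <= N)%nat ->
  qpoch q (q * q) n * qpoch q (q * q) n = symsum (theta_coef q n) N.
Proof.
  intros Hq. revert N. induction n as [|n IH]; intros N HN.
  - assert (H : symsum (theta_coef q 0) 0 = 1).
    { rewrite symsum_0. unfold theta_coef, qbin. simpl. field. }
    clear HN. induction N as [|N IHN].
    + rewrite H. simpl. ring.
    + rewrite symsum_S, <- IHN. unfold theta_coef. rewrite qbin_small by lia. ring.
  - rewrite (symsum_three_term (theta_coef q n) _ (1 + cpow q (2 * (2 * n + 1)))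
               (cpow q (2 * n + 1))).
    2: now apply theta_coef_rec_0.
    2: intros; now apply theta_coef_rec.
    rewrite <- IH by lia.
    replace (theta_coef q n N) with (RtoC 0)
      by (unfold theta_coef; rewrite qbin_small by lia; ring).
    replace (theta_coef q n (S N)) with (RtoC 0)
      by (unfold theta_coef; rewrite qbin_small by lia; ring).
    replace (2 * (2 * n + 1))%nat with (2 * n + 1 + (2 * n + 1))%nat by lia.
    rewrite cpow_add. replace (2 * n + 1)%nat with (S (n + n)) by lia.
    cbn [qpoch cpow]. rewrite cpow_Cmult, cpow_add. ring.
Qed.

Lemma cpow_m1_square (s : nat) : cpow (-1) (s * s) = cpow (-1) s.
Proof.
  destruct (Nat.Even_or_Odd s) as [[k ->]|[k ->]].
  - replace (2 * k * (2 * k))%nat with (2 * (2 * k * k))%nat by lia.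
    now rewrite !cpow_m1_double.
  - replace ((2 * k + 1) * (2 * k + 1))%nat with (2 * (2 * k * k + 2 * k) + 1)%nat by lia.
    now rewrite !cpow_add, !cpow_m1_double.
Qed.

Lemma cpow_m1_sqr1 (s : nat) : cpow (-1) s * cpow (-1) s = 1.
Proof.
  rewrite <- cpow_add. replace (s + s)%nat with (2 * s)%nat by lia. apply cpow_m1_double.
Qed.

(** Replacing $q$ by $-q$ keeps $q^2$ and multiplies the $s$-th coefficient by $(-1)^{s^2}=(-1)^s$,
    so the two expansions differ exactly by the alternating sign. *)
Lemma even_part_triple_product (q : C) (n N : nat) : (Cmod q < 1)%R -> (n <= N)%nat ->
  qpoch q (q * q) n * qpoch q (q * q) n + qpoch (- q) (q * q) n * qpoch (- q) (q * q) n
  = 2 * symsum (fun j => cpow q (4 * j * j) * qbin (q * q) n (2 * j)) N.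
Proof.
  intros Hq HN. rewrite (finite_triple_product q n (2 * N)) by (auto; lia).
  replace (q * q) with (- q * - q) at 1 2 by ring.
  rewrite (finite_triple_product (- q) n (2 * N)) by (rewrite ?Cmod_opp; auto; lia).
  rewrite (symsum_ext _ (fun j => cpow q ((2 * j) * (2 * j)) * qbin (q * q) n (2 * j)) N)
    by (intros j _; now replace (2 * j * (2 * j))%nat with (4 * j * j)%nat by lia).
  rewrite <- (symsum_even_part (fun s => cpow q (s * s) * qbin (q * q) n s) N).
  rewrite Cplus_comm. f_equal. apply symsum_ext. intros s _.
  unfold theta_coef. rewrite cpow_neg, cpow_m1_square.
  replace (- q * - q) with (q * q) by ring.
  rewrite !Cmult_assoc, cpow_m1_sqr1. ring.
Qed.

Lemma S_term_even_part (q : C) (n N : nat) : (Cmod q < 1)%R -> (n <= N)%nat ->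
  S_term q n + S_term (- q) n
  = 2 * csum (fun j => sym_weight j * (cpow q (4 * j * j) *
        (cpow (q * q) n * qbin (q * q) n (2 * j) / qpoch (- (q * q)) (q * q) n))) (S N).
Proof.
  intros Hq HN. unfold S_term.
  replace (- q * - q) with (q * q) by ring.
  replace (cpow (- q) (2 * n)) with (cpow q (2 * n))
    by (rewrite (cpow_neg q), cpow_m1_double; ring).
  replace (cpow q (2 * n)) with (cpow (q * q) n)
    by (rewrite cpow_mul; f_equal; simpl; ring).
  set (e := qpoch (- (q * q)) (q * q) n).
  transitivity ((qpoch q (q * q) n * qpoch q (q * q) n
    + qpoch (- q) (q * q) n * qpoch (- q) (q * q) n) * (cpow (q * q) n / e));
    [unfold Cdiv; ring|].
  rewrite (even_part_triple_product q n N Hq HN). unfold symsum.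
  rewrite <- Cmult_assoc, Cmult_comm with (x := csum _ _), <- csum_scal.
  f_equal. apply csum_ext. intros j _. unfold Cdiv. ring.
Qed.

(** * The even part of the generating function *)

Lemma gam_qbin (q : C) (s m : nat) : (Cmod q < 1)%R ->
  cpow q (s + m) * qbin q (s + m) s / qpoch (- q) q (s + m) = cpow q s * gam q s m.
Proof.
  intros Hq.
  assert (Hq' : (Cmod q <= Cmod q)%R) by lra.
  assert (Hq'' : (Cmod (- q) <= Cmod q)%R) by (rewrite Cmod_opp; lra).
  rewrite qbin_add, cpow_add. unfold gam. rewrite (Nat.add_comm m s). field.
  repeat split; now apply qpoch_neq0.
Qed.

Lemma qbin_term_Cmod_le (q : C) (s n : nat) : (Cmod q < 1)%R ->
  (Cmod (cpow q n * qbin q n s / qpoch (- q) q n)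
   <= poch_bound (Cmod q) ^ 4 * Cmod q ^ n)%R.
Proof.
  intros Hq. pose proof (Cmod_ge_0 q).
  destruct (le_lt_dec s n) as [H1|H1].
  - replace n with (s + (n - s))%nat by lia.
    rewrite gam_qbin by exact Hq. rewrite Cmod_mult, Cmod_cpow, pow_add.
    pose proof (gam_Cmod_le q s (n - s) Hq).
    rewrite (Rmult_comm (poch_bound _ ^ 4)), Rmult_assoc, (Rmult_comm (Cmod q ^ (n - s))).
    apply Rmult_le_compat_l; [apply pow_le; lra|assumption].
  - rewrite qbin_small by exact H1. unfold Cdiv. rewrite Cmult_0_r, Cmult_0_l, Cmod_0.
    apply Rmult_le_pos; apply pow_le; [|lra]. left. apply poch_bound_pos.
Qed.

Lemma qbin_series (q : C) (s : nat) : (Cmod q < 1)%R ->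
  cv (csum (fun n => cpow q n * qbin q n s / qpoch (- q) q n)) (cpow q s * Gam q s).
Proof.
  intros Hq. apply (cv_incr_n s).
  apply cv_ext with (fun n => cpow q s * csum (gam q s) n).
  - intros n. rewrite Nat.add_comm, csum_add, <- csum_scal.
    rewrite (csum_ext _ (fun _ => 0) s).
    + rewrite csum_0, Cplus_0_l. apply csum_ext. intros m _.
      symmetry. now apply gam_qbin.
    + intros k Hk. rewrite qbin_small by exact Hk. unfold Cdiv. ring.
  - apply cv_scal. now apply Gam_cv.
Qed.

Lemma Cmod_sym_weight (j : nat) : (Cmod (sym_weight j) <= 2)%R.
Proof.
  destruct j; simpl; [rewrite Cmod_1; lra|].
  rewrite Cmod_R, Rabs_pos_eq; lra.
Qed.

(* The summand of the right-hand side indexed by [|j|], in terms of [f], [e],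
   the limits of [(Q;Q)_n] and [(-Q;Q)_n] with [Q = q^2]. *)
Definition even_term (q f e : C) (j : nat) : C :=
  sym_weight j * (cpow q (4 * j * j)
    * (cpow (q * q) (2 * j) * (f * e * Gam (q * q) (2 * j)))).

(** For finite $N$ the sums over $n$ and $j$ are exchanged outright; then $N\to\infty$ under the sum
    over $j$. There $|q|^{4j^2}\le|q|^j$ gives the decay, and the two prefactors and the inner sum
    are bounded uniformly in $N$ and $j$. *)
Lemma even_part_cv (q f e : C) : (Cmod q < 1)%R ->
  cv (qpoch (q * q) (q * q)) f -> cv (qpoch (- (q * q)) (q * q)) e ->
  exists v, cv (csum (even_term q f e)) v /\
    cv (fun N => qpoch (q * q) (q * q) N * qpoch (- (q * q)) (q * q) N *
          ((csum (S_term q) N + csum (S_term (- q)) N) / 2)) v.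
Proof.
  intros Hq Hf He.
  pose proof (Cmod_square_lt1 q Hq) as HQ.
  pose proof (Cmod_ge_0 q) as Hq0. pose proof (Cmod_ge_0 (q * q)) as HQ0.
  set (Q := q * q) in *. set (K := poch_bound (Cmod Q)).
  set (u := fun N j => sym_weight j * (cpow q (4 * j * j) *
    (qpoch Q Q N * qpoch (- Q) Q N *
     csum (fun n => cpow Q n * qbin Q n (2 * j) / qpoch (- Q) Q n) N))).
  destruct (tannery_partial u (even_term q f e)
     (2 * (K * K * (K ^ 4 / (1 - Cmod Q)))) (Cmod q)) as [v [Hv1 Hv2]].
  - lra.
  - intros N j. unfold u.
    replace (2 * (K * K * (K ^ 4 / (1 - Cmod Q))) * Cmod q ^ j)%R
      with (2 * (Cmod q ^ j * (K * K * (K ^ 4 / (1 - Cmod Q)))))%R by ring.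
    apply Cmod_mult_le; [apply Cmod_sym_weight|].
    apply Cmod_mult_le; [apply Cmod_cpow_le; [exact Hq|nia]|].
    apply Cmod_mult_le; [apply Cmod_mult_le; apply qpoch_Cmod_le_bound|].
    + exact HQ.
    + lra.
    + exact HQ.
    + rewrite Cmod_opp. lra.
    + apply csum_Cmod_geom; [lra|]. intros k. now apply qbin_term_Cmod_le.
  - intros j. unfold u, even_term. fold Q.
    apply cv_scal, cv_scal.
    replace (cpow Q (2 * j) * (f * e * Gam Q (2 * j)))
      with (f * e * (cpow Q (2 * j) * Gam Q (2 * j))) by ring.
    apply cv_mult; [now apply cv_mult|now apply qbin_series].
  - exists v. split; [exact Hv1|].
    (* For a cutoff [S N] both $n$ and $j$ run up to [N], so the even parts of all terms expand over
       one common range of $j$. *)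
    revert Hv2. apply cv_ext. intros [|N].
    + simpl. unfold Cdiv. ring.
    + rewrite <- csum_plus.
      rewrite (csum_ext (fun k => S_term q k + S_term (- q) k)
        (fun n => 2 * csum (fun j => sym_weight j * (cpow q (4 * j * j) *
        (cpow Q n * qbin Q n (2 * j) / qpoch (- Q) Q n))) (S N)))
        by (intros n Hn; apply S_term_even_part; [exact Hq|lia]).
      rewrite csum_scal, csum_exchange.
      transitivity (qpoch Q Q (S N) * qpoch (- Q) Q (S N) *
        csum (fun j => csum (fun n => sym_weight j * (cpow q (4 * j * j) *
        (cpow Q n * qbin Q n (2 * j) / qpoch (- Q) Q n))) (S N)) (S N)).
      * rewrite <- csum_scal. apply csum_ext. intros j _. unfold u.
        rewrite !csum_scal. ring.
      * f_equal. field.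
Qed.

(** * The Hecke-type double sum *)

Lemma csum_S_first (a : nat -> C) (n : nat) :
  csum a (S n) = a O + csum (fun k => a (S k)) n.
Proof. change (S n) with (1 + n)%nat. rewrite csum_add. simpl. ring. Qed.

Lemma csum_rev (a : nat -> C) (n : nat) :
  csum (fun k => a (n - k)%nat) n = csum (fun k => a (S k)) n.
Proof.
  induction n as [|n IH]; [reflexivity|].
  rewrite csum_S_first. simpl. rewrite <- IH. ring.
Qed.

Lemma csum_symmetric (phi : nat -> C) (n : nat) :
  csum (fun k => phi (Z.abs_nat (Z.of_nat k - Z.of_nat n))) (S (2 * n)) = symsum phi n.
Proof.
  replace (S (2 * n)) with (n + S n)%nat by lia. rewrite csum_add.
  rewrite (csum_ext _ (fun k => phi (n - k)%nat) n) by (intros; f_equal; lia).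
  rewrite (csum_ext _ phi (S n)) by (intros; f_equal; lia).
  rewrite csum_rev.
  transitivity (2 * csum (fun k => phi (S k)) n + phi O).
  - rewrite csum_S_first. ring.
  - unfold symsum. rewrite csum_S_first, <- csum_scal. simpl. ring.
Qed.

(** With $n=k+j$ the exponent $6n^2+4n-2j^2$ equals $4j^2+4j+2(3k^2+2k+6kj)$ and $4n+2=2(2k+1+2j)$,
    so the natural-number subtractions are exact. The signs combine to $(-1)^n(-1)^j=(-1)^k$. *)
Lemma rhs_term_eq (q : C) (n : nat) :
  rhs_term q n = csum (fun j => sym_weight j * (cpow q (4 * j * j)
    * (cpow (q * q) (2 * j) * hecke_term (q * q) (2 * j) (n - j)))) (S n).
Proof.
  unfold rhs_term. rewrite <- csum_sum_n.
  set (phi := fun j => cpow (-1) j * (cpow q (6 * n * n + 4 * n - 2 * j * j)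
       + cpow q (6 * n * n + 8 * n + 2 - 2 * j * j))).
  rewrite (csum_ext _ (fun k => phi (Z.abs_nat (Z.of_nat k - Z.of_nat n)))).
  2: { intros k Hk. cbv zeta. unfold phi. f_equal. f_equal; f_equal; nia. }
  rewrite csum_symmetric. unfold symsum, phi. rewrite <- csum_scal.
  apply csum_ext. intros j Hj.
  assert (Hn : (n = (n - j) + j)%nat) by lia.
  remember (n - j)%nat as k eqn:Hk. clear Hk. subst n.
  unfold hecke_term. rewrite !(cpow_Cmult q q), <- !cpow_add, (cpow_add (-1) k j).
  replace (6 * (k + j) * (k + j) + 4 * (k + j) - 2 * j * j)%nat
    with (4 * j * j + (2 * j + 2 * j) + ((3 * k * k + 2 * k + 3 * k * (2 * j))
          + (3 * k * k + 2 * k + 3 * k * (2 * j))))%nat by nia.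
  replace (6 * (k + j) * (k + j) + 8 * (k + j) + 2 - 2 * j * j)%nat
    with (4 * j * j + (2 * j + 2 * j) + ((3 * k * k + 2 * k + 3 * k * (2 * j))
          + (3 * k * k + 2 * k + 3 * k * (2 * j)))
          + ((2 * k + 1 + 2 * j) + (2 * k + 1 + 2 * j)))%nat by nia.
  rewrite (cpow_add q (4 * j * j + _ + _)), !(cpow_add q (4 * j * j + _)),
    !(cpow_add q (4 * j * j)).
  transitivity (cpow (-1) j * cpow (-1) j * (sym_weight j * (cpow q (4 * j * j)
    * (cpow q (2 * j + 2 * j) * (cpow (-1) k *
    (cpow q (3 * k * k + 2 * k + 3 * k * (2 * j) + (3 * k * k + 2 * k + 3 * k * (2 * j)))
     * (1 + cpow q (2 * k + 1 + 2 * j + (2 * k + 1 + 2 * j))))))))); [ring|].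
  rewrite cpow_m1_sqr1. ring.
Qed.

Lemma hecke_term_Cmod_le (q : C) (s k : nat) : (Cmod q < 1)%R ->
  (Cmod (hecke_term q s k) <= 2 * Cmod q ^ k)%R.
Proof.
  intros Hq. unfold hecke_term. rewrite Cmod_mult, Cmod_cpow_m1, Rmult_1_l, Rmult_comm.
  apply Cmod_mult_le; [apply Cmod_cpow_le; [exact Hq|nia]|].
  eapply Rle_trans; [apply Cmod_triangle|]. rewrite Cmod_1.
  pose proof (Cmod_cpow_le1 q (2 * k + 1 + s) Hq). lra.
Qed.

(** Regrouped by $j$, the first $N$ terms become rows of length $N-j$, each a partial sum of the
    series for $G(2j)$; dominated convergence in $j$ completes every row. *)
Lemma rhs_series (q f e v : C) : (Cmod q < 1)%R ->
  cv (qpoch (q * q) (q * q)) f -> cv (qpoch (- (q * q)) (q * q)) e ->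
  cv (csum (even_term q f e)) v -> cv (csum (rhs_term q)) v.
Proof.
  intros Hq Hf He Hv.
  pose proof (Cmod_square_lt1 q Hq) as HQ.
  pose proof (Cmod_ge_0 q) as Hq0. pose proof (Cmod_ge_0 (q * q)) as HQ0.
  set (Q := q * q) in *.
  set (u := fun N j => sym_weight j * (cpow q (4 * j * j)
    * (cpow Q (2 * j) * csum (hecke_term Q (2 * j)) (N - j)))).
  destruct (tannery_partial u (even_term q f e) (2 * (1 * (2 / (1 - Cmod Q))))
     (Cmod q)) as [w [Hw1 Hw2]].
  - lra.
  - intros N j. unfold u.
    replace (2 * (1 * (2 / (1 - Cmod Q))) * Cmod q ^ j)%R
      with (2 * (Cmod q ^ j * (1 * (2 / (1 - Cmod Q)))))%R by ring.
    apply Cmod_mult_le; [apply Cmod_sym_weight|].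
    apply Cmod_mult_le; [apply Cmod_cpow_le; [exact Hq|nia]|].
    apply Cmod_mult_le; [now apply Cmod_cpow_le1|].
    apply csum_Cmod_geom; [lra|]. intros k. now apply hecke_term_Cmod_le.
  - intros j. unfold u, even_term. fold Q. apply cv_scal, cv_scal, cv_scal.
    apply (cv_incr_n j).
    apply cv_ext with (csum (hecke_term Q (2 * j))).
    + intros n. f_equal. lia.
    + now apply Gam_series.
  - rewrite (cv_unique _ _ _ Hv Hw1). revert Hw2. apply cv_ext. intros N.
    rewrite (csum_ext (rhs_term q) _ N (fun n _ => rhs_term_eq q n)).
    fold Q. rewrite (csum_triangle (fun j k => sym_weight j * (cpow q (4 * j * j)
      * (cpow Q (2 * j) * hecke_term Q (2 * j) k)))).
    apply csum_ext. intros j _. unfold u. now rewrite !csum_scal.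
Qed.

(** * Power series expansion *)

Fixpoint shift (k : nat) (c : nat -> C) (m : nat) : C :=
  match k, m with
  | O, _ => c m
  | S _, O => 0
  | S k', S m' => shift k' c m'
  end.

Lemma shift_lt (k m : nat) (c : nat -> C) : (m < k)%nat -> shift k c m = 0.
Proof.
  revert m. induction k as [|k IH]; intros m H; [lia|].
  destruct m as [|m]; simpl; [reflexivity|apply IH; lia].
Qed.

Definition rep (c : nat -> C) (q x : C) : Prop := cv (csum (fun m => c m * cpow q m)) x.

Lemma rep_plus (c d : nat -> C) (q x y : C) :
  rep c q x -> rep d q y -> rep (fun m => c m + d m) q (x + y).
Proof.
  intros Hc Hd. apply cv_ext with (fun n => csum (fun m => c m * cpow q m) n
    + csum (fun m => d m * cpow q m) n).
  - intros n. rewrite <- csum_plus. apply csum_ext. intros; ring.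
  - now apply cv_plus.
Qed.

Lemma rep_shift (k : nat) (c : nat -> C) (q x : C) :
  rep c q x -> rep (shift k c) q (cpow q k * x).
Proof.
  intros Hc. apply (cv_incr_n k).
  apply cv_ext with (fun n => cpow q k * csum (fun m => c m * cpow q m) n).
  2: now apply cv_scal.
  intros n. induction k as [|k IH].
  - rewrite Nat.add_0_r. simpl. ring.
  - rewrite Nat.add_succ_r, csum_S_first. simpl shift at 1.
    rewrite (csum_ext _ (fun m => q * (shift k c m * cpow q m)) (n + k))
      by (intros; simpl; ring).
    rewrite csum_scal, <- IH. simpl. ring.
Qed.

Definition mul_binom (k : nat) (c : nat -> C) (m : nat) : C := c m - shift k c m.

Lemma rep_mul_binom (k : nat) (c : nat -> C) (q x : C) :
  rep c q x -> rep (mul_binom k c) q (x * (1 - cpow q k)).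
Proof.
  intros Hc. replace (x * (1 - cpow q k)) with (x + (-1) * (cpow q k * x)) by ring.
  apply (cv_ext (csum (fun m => (c m + (-1) * shift k c m) * cpow q m))).
  - intros n. apply csum_ext. intros m _. unfold mul_binom. ring.
  - apply rep_plus; [exact Hc|].
    apply (cv_ext (fun n => (-1) * csum (fun m => shift k c m * cpow q m) n)).
    + intros n. rewrite <- csum_scal. apply csum_ext. intros; ring.
    + apply cv_scal. now apply rep_shift.
Qed.

(** * Weighted norms of coefficient sequences *)

Fixpoint rsum (a : nat -> R) (n : nat) : R :=
  match n with O => 0%R | S k => (rsum a k + a k)%R end.

Lemma rsum_S_first (a : nat -> R) (n : nat) :
  rsum a (S n) = (a O + rsum (fun k => a (S k)) n)%R.
Proof. induction n as [|n IH]; [simpl; ring|]. simpl in *. rewrite IH. ring. Qed.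

Lemma rsum_scal (c : R) (a : nat -> R) (n : nat) :
  rsum (fun k => c * a k)%R n = (c * rsum a n)%R.
Proof. induction n as [|n IH]; simpl; [|rewrite IH]; ring. Qed.

Lemma rsum_ext (a b : nat -> R) (n : nat) : (forall k, a k = b k) -> rsum a n = rsum b n.
Proof. intros H. induction n as [|n IH]; simpl; [|rewrite IH, H]; reflexivity. Qed.

Lemma rsum_le_plus (a b c : nat -> R) (n : nat) :
  (forall k, (a k <= b k + c k)%R) -> (rsum a n <= rsum b n + rsum c n)%R.
Proof. intros H. induction n as [|n IH]; simpl; [lra|]. specialize (H n). lra. Qed.

Lemma rsum_ge_term (a : nat -> R) (n : nat) :
  (forall k, (0 <= a k)%R) -> (a n <= rsum a (S n))%R.
Proof.
  intros H. simpl. assert (Hn : (0 <= rsum a n)%R); [|lra].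
  induction n as [|n IH]; simpl; [lra|]. specialize (H n). lra.
Qed.

(** A bound on the norm $\sum_m|c_m|r^m$, phrased by partial sums. Multiplication by $1-q^k$ costs
    at most a factor $1+r^k$, so arbitrarily long products stay bounded. *)
Definition norm_le (r : R) (c : nat -> C) (B : R) : Prop :=
  forall n, (rsum (fun m => Cmod (c m) * r ^ m)%R n <= B)%R.

Lemma norm_le_weaken (r : R) (c : nat -> C) (A B : R) :
  norm_le r c A -> (A <= B)%R -> norm_le r c B.
Proof. intros H HAB n. specialize (H n). lra. Qed.

Lemma norm_le_nonneg (r : R) (c : nat -> C) (B : R) : norm_le r c B -> (0 <= B)%R.
Proof. intros H. apply (H O). Qed.

Lemma norm_le_add (r : R) (a b c : nat -> C) (A B : R) : (0 <= r)%R ->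
  (forall m, (Cmod (c m) <= Cmod (a m) + Cmod (b m))%R) ->
  norm_le r a A -> norm_le r b B -> norm_le r c (A + B).
Proof.
  intros Hr Hc HA HB n. specialize (HA n). specialize (HB n).
  eapply Rle_trans; [apply rsum_le_plus with (b := fun m => (Cmod (a m) * r ^ m)%R)
                       (c := fun m => (Cmod (b m) * r ^ m)%R)|lra].
  intros m. rewrite <- Rmult_plus_distr_r.
  apply Rmult_le_compat_r; [now apply pow_le|apply Hc].
Qed.

Lemma norm_le_shift (r : R) (k : nat) (c : nat -> C) (B : R) : (0 <= r)%R ->
  norm_le r c B -> norm_le r (shift k c) (r ^ k * B).
Proof.
  intros Hr HB. assert (HB0 := norm_le_nonneg _ _ _ HB).
  induction k as [|k IH]; intros n.
  - simpl. rewrite Rmult_1_l. apply HB.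
  - destruct n as [|n].
    + simpl. apply Rmult_le_pos; [|exact HB0].
      apply Rmult_le_pos; [exact Hr|now apply pow_le].
    + rewrite rsum_S_first. simpl shift at 1. rewrite Cmod_0.
      rewrite (rsum_ext _ (fun m => r * (Cmod (shift k c m) * r ^ m))%R)
        by (intros; simpl; ring).
      rewrite rsum_scal. specialize (IH n). simpl. nra.
Qed.

Lemma norm_le_mul_binom (r : R) (k n : nat) (c : nat -> C) (B : R) :
  (0 <= r < 1)%R -> (n <= k)%nat ->
  norm_le r c B -> norm_le r (mul_binom k c) ((1 + r ^ n) * B).
Proof.
  intros Hr Hk HB. assert (HB0 := norm_le_nonneg _ _ _ HB).
  apply norm_le_weaken with (B + r ^ k * B)%R.
  - apply norm_le_add with c (shift k c); [lra| |exact HB|now apply norm_le_shift].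
    intros m. apply Cmod_sub_le.
  - assert (r ^ k <= r ^ n)%R by (apply pow_le_1_anti; [lra|exact Hk]). nra.
Qed.

(** Majorant for [poch_coef]: step $k$ multiplies by three binomials, with exponents $2k+1$, $2k+1$
    and $2k+2$, all at least $k$. *)
Fixpoint cube_prod (r : R) (n : nat) : R :=
  match n with O => 1%R | S k => (cube_prod r k * (1 + r ^ k) ^ 3)%R end.

Lemma cube_prod_le (r : R) (n : nat) : (0 <= r < 1)%R ->
  (0 <= cube_prod r n <= exp (3 / (1 - r)))%R.
Proof.
  intros Hr.
  assert (H : (0 <= cube_prod r n <= exp (3 * ((1 - r ^ n) / (1 - r))))%R).
  { induction n as [|n IH].
    - simpl. replace (3 * ((1 - 1) / (1 - r)))%R with 0%R by (field; lra).
      rewrite exp_0. lra.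
    - assert (Hp : (0 <= r ^ n)%R) by (apply pow_le; lra).
      cbn [cube_prod].
      replace (3 * ((1 - r ^ S n) / (1 - r)))%R
        with (3 * ((1 - r ^ n) / (1 - r)) + (r ^ n + (r ^ n + r ^ n)))%R
        by (simpl; field; lra).
      rewrite !exp_plus.
      assert (H1 : (0 <= 1 + r ^ n <= exp (r ^ n))%R)
        by (split; [lra|apply exp_ineq1_le]).
      assert (H3 : (0 <= (1 + r ^ n) ^ 3 <= exp (r ^ n) * (exp (r ^ n) * exp (r ^ n)))%R).
      { split; [apply pow_le; lra|].
        replace (exp (r ^ n) * (exp (r ^ n) * exp (r ^ n)))%R with (exp (r ^ n) ^ 3)%R by ring.
        now apply pow_incr. }
      split; [apply Rmult_le_pos; lra|].
      apply Rmult_le_compat; lra. }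
  split; [apply H|]. eapply Rle_trans; [apply H|].
  assert (Hp : (0 <= r ^ n)%R) by (apply pow_le; lra).
  assert (Hi : (0 < / (1 - r))%R) by (apply Rinv_0_lt_compat; lra).
  assert (Hle : (3 * ((1 - r ^ n) / (1 - r)) <= 3 / (1 - r))%R) by (unfold Rdiv; nra).
  destruct Hle as [Hlt|Heq]; [left; now apply exp_increasing|rewrite Heq; lra].
Qed.

Definition unit_coef (m : nat) : C := match m with O => 1 | _ => 0 end.

(* Coefficients of [(q;q^2)_n^2 (q^2;q^2)_n]. *)
Fixpoint poch_coef (n : nat) : nat -> C :=
  match n with
  | O => unit_coef
  | S k => mul_binom (2 * k + 1) (mul_binom (2 * k + 1) (mul_binom (2 * k + 2) (poch_coef k)))
  end.

(* Coefficients of [(q^4;q^4)_n] times the [n]-th partial sum of [S]. *)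
Fixpoint partial_coef (n : nat) : nat -> C :=
  match n with
  | O => fun _ => 0
  | S k => mul_binom (4 * k + 4)
             (fun m => partial_coef k m + shift (2 * k) (poch_coef k) m)
  end.

(** Step $k$ of [partial_coef] changes only degrees at least $2k$, so the coefficient of degree [m]
    is final from stage [S m] on. *)
Definition limit_coef (m : nat) : C := partial_coef (S m) m.

Lemma poch_coef_norm (r : R) (n : nat) : (0 <= r < 1)%R ->
  norm_le r (poch_coef n) (cube_prod r n).
Proof.
  intros Hr. induction n as [|n IH].
  - intros k. destruct k as [|k]; [simpl; lra|]. rewrite rsum_S_first. simpl.
    rewrite Cmod_1, (rsum_ext _ (fun _ => 0 * 0)%R)
      by (intros; rewrite Cmod_0; ring).
    rewrite rsum_scal. lra.
  - simpl cube_prod.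
    replace (cube_prod r n * _)%R
      with ((1 + r ^ n) * ((1 + r ^ n) * ((1 + r ^ n) * cube_prod r n)))%R by ring.
    cbn [poch_coef]. repeat (apply norm_le_mul_binom; [exact Hr|lia|]). exact IH.
Qed.

Lemma partial_coef_norm (r : R) (n : nat) : (0 <= r < 1)%R ->
  norm_le r (partial_coef n) (exp (3 / (1 - r)) * exp (3 / (1 - r))).
Proof.
  intros Hr. set (K := exp (3 / (1 - r))).
  assert (HK : (0 <= K)%R) by (apply Rlt_le, exp_pos).
  (* Subtracting [K] makes the bound 0 at the start and leaves room for the summand of norm at most
     $r^nK$ added at each step. *)
  assert (H : norm_le r (partial_coef n) (K * cube_prod r n - K)).
  { induction n as [|n IH].
    - intros k. simpl. rewrite (rsum_ext _ (fun _ => 0 * 0)%R)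
        by (intros; rewrite Cmod_0; ring).
      rewrite rsum_scal. lra.
    - assert (Hp : (0 <= r ^ n)%R) by (apply pow_le; lra).
      destruct (cube_prod_le r n Hr) as [Hc0 Hc1]. fold K in Hc1.
      cbn [partial_coef].
      apply norm_le_weaken
        with ((1 + r ^ n) * ((K * cube_prod r n - K) + r ^ n * K))%R.
      + apply norm_le_mul_binom; [exact Hr|lia|].
        apply norm_le_add with (partial_coef n) (shift (2 * n) (poch_coef n)); [lra| |exact IH|].
        * intros m. apply Cmod_triangle.
        * apply norm_le_weaken with (r ^ (2 * n) * K)%R.
          -- apply norm_le_shift; [lra|].
             apply norm_le_weaken with (cube_prod r n); [now apply poch_coef_norm|exact Hc1].
          -- apply Rmult_le_compat_r; [exact HK|]. apply pow_le_1_anti; [lra|lia].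
      + cbn [cube_prod].
        (* A norm bound is nonnegative, so the induction hypothesis itself yields $K\le y$. *)
        assert (H0 := norm_le_nonneg _ _ _ IH). set (x := (r ^ n)%R) in *.
        set (y := (K * cube_prod r n)%R) in *.
        replace (K * (cube_prod r n * (1 + x) ^ 3))%R with (y * (1 + x) ^ 3)%R
          by (unfold y; ring).
        assert (Hxy : (K * x <= y * x)%R) by nra.
        assert (0 <= y * x)%R by nra. assert (0 <= y * x * x)%R by nra.
        assert (0 <= y * x * x * x)%R by (apply Rmult_le_pos; nra).
        assert (K * x * x <= y * x * x)%R by nra. nra. }
  apply norm_le_weaken with (1 := H).
  destruct (cube_prod_le r n Hr) as [_ Hc1]. fold K in Hc1. nra.
Qed.

Lemma unit_rep (q : C) : rep unit_coef q 1.
Proof.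
  apply (cv_incr_n 1). apply cv_ext with (fun _ => 1); [|apply cv_const].
  intros n. rewrite Nat.add_1_r, csum_S_first. simpl.
  rewrite (csum_ext _ (fun _ => 0)) by (intros; ring). rewrite csum_0. ring.
Qed.

Lemma poch_coef_rep (q : C) (n : nat) :
  rep (poch_coef n) q
    (qpoch q (q * q) n * qpoch q (q * q) n * qpoch (q * q) (q * q) n).
Proof.
  induction n as [|n IH]; cbn [poch_coef qpoch].
  - replace (1 * 1 * 1) with (RtoC 1) by ring. apply unit_rep.
  - replace (q * cpow (q * q) n) with (cpow q (2 * n + 1))
      by (rewrite cpow_Cmult; replace (2 * n + 1)%nat with (S (n + n)) by lia;
          cbn [cpow]; now rewrite cpow_add).
    replace (q * q * cpow (q * q) n) with (cpow q (2 * n + 2))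
      by (rewrite cpow_Cmult; replace (2 * n + 2)%nat with (S (S (n + n))) by lia;
          cbn [cpow]; rewrite cpow_add; ring).
    match goal with |- rep _ _ ?x => replace x with
      (qpoch q (q * q) n * qpoch q (q * q) n * qpoch (q * q) (q * q) n
       * (1 - cpow q (2 * n + 2)) * (1 - cpow q (2 * n + 1)) * (1 - cpow q (2 * n + 1)))
      by ring end.
    now repeat apply rep_mul_binom.
Qed.

Definition partial_val (q : C) (n : nat) : C :=
  qpoch (q * q) (q * q) n * qpoch (- (q * q)) (q * q) n * csum (S_term q) n.

(** The new term of $S$ has denominator $(-q^2;q^2)_n$, which the prefactor cancels:
    $q^{2n}(q;q^2)_n^2(q^2;q^2)_n$ is added before multiplying by the next factor $1-q^{4n+4}$. *)
Lemma partial_coef_rep (q : C) (n : nat) : (Cmod q < 1)%R ->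
  rep (partial_coef n) q (partial_val q n).
Proof.
  intros Hq. assert (HQ := Cmod_square_lt1 q Hq).
  induction n as [|n IH].
  - unfold partial_val. simpl. rewrite Cmult_0_r. unfold rep.
    apply cv_ext with (fun _ => 0); [|apply cv_const].
    intros n. rewrite (csum_ext _ (fun _ => 0)) by (intros; ring).
    now rewrite csum_0.
  - replace (partial_val q (S n))
      with ((partial_val q n + cpow q (2 * n)
             * (qpoch q (q * q) n * qpoch q (q * q) n * qpoch (q * q) (q * q) n))
            * (1 - cpow q (4 * n + 4))).
    + apply rep_mul_binom, rep_plus; [exact IH|]. apply rep_shift, poch_coef_rep.
    + unfold partial_val, S_term. cbn [qpoch csum].
      replace (4 * n + 4)%nat with (S (S (S (S (n + n + (n + n)))))) by lia.
      cbn [cpow]. rewrite (cpow_Cmult q q), !cpow_add. field.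
      apply qpoch_neq0; [exact HQ|rewrite Cmod_opp; lra].
Qed.

Lemma partial_coef_stable (m n : nat) : (S m <= n)%nat -> partial_coef n m = limit_coef m.
Proof.
  intros H. induction H as [|n Hn IH]; [reflexivity|].
  rewrite <- IH. cbn [partial_coef]. unfold mul_binom.
  rewrite !shift_lt by lia. ring.
Qed.

Lemma limit_coef_series (q : C) : (Cmod q < 1)%R ->
  exists v, rep limit_coef q v /\ cv (partial_val q) v.
Proof.
  intros Hq. pose proof (Cmod_ge_0 q) as Hq0.
  (* A radius strictly between $|q|$ and 1: the norm bound there gives $|c_m|\le B\rho^{-m}$ for
     every partial product, hence the geometric ratio $|q|/\rho<1$. *)
  set (rho := ((1 + Cmod q) / 2)%R).
  assert (Hrho : (0 < rho < 1 /\ Cmod q < rho)%R) by (unfold rho; lra).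
  set (B := (exp (3 / (1 - rho)) * exp (3 / (1 - rho)))%R).
  apply (tannery (fun n m => partial_coef n m * cpow q m) _ _ B (Cmod q / rho)%R).
  - split; [apply Rmult_le_pos; [lra|apply Rlt_le, Rinv_0_lt_compat; lra]|].
    apply Rmult_lt_reg_r with rho; [lra|]. unfold Rdiv.
    rewrite Rmult_assoc, Rinv_l by lra. lra.
  - intros n m.
    assert (Hb : (Cmod (partial_coef n m) * rho ^ m <= B)%R).
    { eapply Rle_trans; [|apply (partial_coef_norm rho n ltac:(lra) (S m))].
      apply (rsum_ge_term (fun m => Cmod (partial_coef n m) * rho ^ m)%R).
      intros k. apply Rmult_le_pos; [apply Cmod_ge_0|apply pow_le; lra]. }
    rewrite Cmod_mult, Cmod_cpow.
    replace (Cmod (partial_coef n m) * Cmod q ^ m)%R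
      with (Cmod (partial_coef n m) * rho ^ m * (Cmod q / rho) ^ m)%R.
    + apply Rmult_le_compat_r; [|exact Hb]. apply pow_le.
      apply Rmult_le_pos; [lra|apply Rlt_le, Rinv_0_lt_compat; lra].
    + rewrite Rmult_assoc, <- Rpow_mult_distr. do 2 f_equal. field. lra.
  - intros m. apply cv_eventually_eq with (fun _ => limit_coef m * cpow q m) (S m);
      [|apply cv_const].
    intros n Hn. now rewrite partial_coef_stable.
  - intros n. now apply partial_coef_rep.
Qed.

Lemma qpoch_mul_neg (x : C) (n : nat) :
  qpoch (x * x) (x * x) n = qpoch x x n * qpoch (- x) x n.
Proof.
  induction n as [|n IH]; simpl; [ring|]. rewrite IH, cpow_Cmult. ring.
Qed.

Lemma S_term_series (q : C) : (Cmod q < 1)%R -> exists s, cv (csum (S_term q)) s.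
Proof.
  intros Hq. assert (HQ := Cmod_square_lt1 q Hq).
  pose proof (Cmod_ge_0 (q * q)) as HQ0.
  set (K := poch_bound (Cmod (q * q))).
  apply (ex_series_geom_le _ (K * K * K) (Cmod (q * q))); [lra|].
  intros n. unfold S_term, Cdiv.
  replace (K * K * K * Cmod (q * q) ^ n)%R with (K * K * Cmod (q * q) ^ n * K)%R by ring.
  apply Cmod_mult_le; [apply Cmod_mult_le; [apply Cmod_mult_le|]|].
  - apply qpoch_Cmod_le_bound; [exact HQ|lra].
  - apply qpoch_Cmod_le_bound; [exact HQ|lra].
  - replace (cpow q (2 * n)) with (cpow (q * q) n)
      by (rewrite cpow_mul; f_equal; simpl; ring).
    rewrite Cmod_cpow. lra.
  - apply qpoch_inv_Cmod_le; [exact HQ|rewrite Cmod_opp; lra].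
Qed.

(* There is a power series sum c(n) q^n representing (q^4;q^4)_oo S(q) on |q|<1,
   and its S_{2,0}-sieved part equals the right-hand side on |q|<1. *)
Theorem theorem1p2 :
  exists c : nat -> C,
    (forall q : C, (Cmod q < 1)%R ->
       exists P s : C,
         qpoch_inf_is (cpow q 4) (cpow q 4) P /\
         is_series (S_term q) s /\
         is_series (fun n => c n * cpow q n) (P * s)) /\
    (forall q : C, (Cmod q < 1)%R ->
       exists v : C,
         is_series (rhs_term q) v /\
         is_series (sieve20_term c q) v).
Proof.
  exists limit_coef.
  assert (Hfe : forall q, (Cmod q < 1)%R -> exists f e,
    cv (qpoch (q * q) (q * q)) f /\ cv (qpoch (- (q * q)) (q * q)) e).
  { intros q Hq. assert (HQ := Cmod_square_lt1 q Hq).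
    destruct (qpoch_cv (q * q) (q * q)) as [f Hf]; [exact HQ|lra|].
    destruct (qpoch_cv (- (q * q)) (q * q)) as [e He]; [exact HQ|rewrite Cmod_opp; lra|].
    now exists f, e. }
  split; intros q Hq; destruct (Hfe q Hq) as [f [e [Hf He]]].
  - destruct (S_term_series q Hq) as [s Hs].
    destruct (limit_coef_series q Hq) as [v [Hv1 Hv2]].
    exists (f * e), s. repeat split.
    + apply cv_iff_filterlim.
      apply cv_ext with (fun n => qpoch (q * q) (q * q) n * qpoch (- (q * q)) (q * q) n).
      * intros n. rewrite <- qpoch_mul_neg. f_equal; simpl; ring.
      * now apply cv_mult.
    + now apply is_series_cv.
    (* [partial_val] has two descriptions of its limit: the product $P\,s$ by the limit laws, and
       the sum of the power series by coefficientwise convergence. *)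
    + apply is_series_cv. rewrite (cv_unique (partial_val q) (f * e * s) v); [exact Hv1| |exact Hv2].
      apply cv_mult; [now apply cv_mult|exact Hs].
  - assert (Hmq : (Cmod (- q) < 1)%R) by (now rewrite Cmod_opp).
    destruct (limit_coef_series q Hq) as [v [Hv1 Hv2]].
    destruct (limit_coef_series (- q) Hmq) as [v' [Hv1' Hv2']].
    destruct (even_part_cv q f e Hq Hf He) as [w [Hw1 Hw2]].
    exists w. split; apply is_series_cv; [now apply (rhs_series q f e)|].
    (* Sieving is averaging over $q$ and $-q$. Both values carry the same prefactor, which depends
       on $q^2$ only, so their mean has the limit [w] already found. *)
    replace w with (/ 2 * (v + v')).
    + apply cv_ext with (fun n => / 2 * (csum (fun m => limit_coef m * cpow q m) n
          + csum (fun m => limit_coef m * cpow (- q) m) n)).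
      * intros n. rewrite <- csum_plus, <- csum_scal. apply csum_ext. intros m _.
        unfold sieve20_term. rewrite cpow_neg.
        destruct (Nat.Even_or_Odd m) as [[k ->]|[k ->]].
        -- rewrite Nat.even_mul. rewrite cpow_m1_double. simpl orb. cbv iota. field.
        -- rewrite Nat.even_add, Nat.even_mul. rewrite (cpow_add (-1)), cpow_m1_double.
           simpl. field.
      * apply cv_scal. now apply cv_plus.
    + apply (cv_unique _ _ _ (cv_scal (/ 2) _ _ (cv_plus _ _ _ _ Hv2 Hv2'))).
      revert Hw2. apply cv_ext. intros n. unfold partial_val.
      replace (- q * - q) with (q * q) by ring. unfold Cdiv. ring.
Qed.
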